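(* Let $\Omega\subset\mathbb{R}^n$, $n\ge1$, be an open bounded domain with sufficiently smooth boundary $\partial\Omega$, and let $p\ge2$. (1) Let $\Delta_p$, $\Delta_pu=\nabla\cdot(|\nabla u|^{p-2}\nabla u)$, be the $p$-Laplacian on $\Omega$ with homogeneous Dirichlet boundary condition, and let $p_0,p_1\ge0$ with $p_0+p_1=p$. Then the first eigenvalue $\lambda_{p_0,p_1}$ of the operator $-\Delta_p$ relative to the operator $G$, $G(u)=|u|^{p_0-2}u|\nabla u|^{p_1}$, exists and is given by $$\lambda_{p_0,p_1}=\inf\left\{\|\nabla u\|_p\left[\int_\Omega|u|^{p_0}|\nabla u|^{p_1}\,dx\right]^{-1/p}:\ u\in S_1^{W_0^{1,p}(\Omega)}(0)\right\}.$$ (2) Let $F(u)=-\nabla\cdot(|u|^{p-2}\nabla u)$ and $G(u)=|u|^{p-2}u$, with homogeneous Dirichlet boundary condition $u|_{\partial\Omega}=0$. Then the first eigenvalue $\lambda_1(p)$ of $F$ relative to $G$ is $$\lambda_1(p)=\left(\frac{2}{p}\,\lambda_1(-\Delta)\right)^2,$$ where $\lambda_1(-\Delta)=\inf\{\|\nabla v\|_2/\|v\|_2:\ v\in W_0^{1,2}(\Omega),\ v\neq0\}$ is the first eigenvalue of the Laplacian.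
   Context: $\|\cdot\|_p$ is the norm of $L^p(\Omega)$ and $S_1^{W_0^{1,p}(\Omega)}(0)$ is the unit sphere of $W_0^{1,p}(\Omega)$. The operators act from $W_0^{1,p}(\Omega)$ to $W^{-1,q}(\Omega)$, $q=p/(p-1)$. For operators $F,G$ that are homogeneous of the same degree, the paper's first eigenvalue of $F$ relative to $G$ is a number independent of the elements $u$, obtained as the infimum over $u\ne0$ of the quotient $\langle F(u),u\rangle/\langle G(u),u\rangle$. In part (2) it is exactly this infimum, $$\lambda_1(p)=\inf\left\{\frac{\int_\Omega|u|^{p-2}|\nabla u|^2dx}{\int_\Omega|u|^pdx}:\ u\in W_0^{1,p}(\Omega),\ u\ne0\right\}.$$ In part (1) the paper uses the $p$-th root normalization: the first eigenvalue (''first spectrum'') $\lambda_{p_0,p_1}$ of $-\Delta_p$ relative to $G$ is the infimum of $\left(\langle-\Delta_pu,u\rangle/\langle G(u),u\rangle\right)^{1/p}$ with $\langle-\Delta_pu,u\rangle=\|\nabla u\|_p^p$ and $\langle G(u),u\rangle=\int_\Omega|u|^{p_0}|\nabla u|^{p_1}dx$. The paper's $\lambda_1(-\Delta)$ is the infimum of the ratio of norms (not of squared norms), as written in the claim. *)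

(* Defs.v *)
From HB Require Import structures.
From mathcomp Require Import all_boot all_order all_algebra.
From mathcomp Require Import all_classical all_reals all_analysis.

Set Implicit Arguments.
Unset Strict Implicit.
Unset Printing Implicit Defensive.

Import Order.TTheory GRing.Theory Num.Theory.
Import numFieldNormedType.Exports.

Local Open Scope classical_set_scope.
Local Open Scope ring_scope.

(* R^n is 'rV[R]_n, with the sigma-algebra generated by the coordinates (the
   Borel sets of R^n). *)
Section row_measurable.
Context {R : realType} (n : nat).

Let coord (i : 'I_n) (x : 'rV[R]_n) : R := x ord0 i.

Let row_set0 : g_sigma_preimage coord set0.
Proof. exact: sigma_algebra0. Qed.

Let row_setC A : g_sigma_preimage coord A -> g_sigma_preimage coord (~` A).
Proof. exact: sigma_algebraC. Qed.

Let row_bigcup (F : (set 'rV[R]_n)^nat) :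
  (forall i, g_sigma_preimage coord (F i)) ->
  g_sigma_preimage coord (\bigcup_i (F i)).
Proof. exact: sigma_algebra_bigcup. Qed.

HB.instance Definition _ := @isMeasurable.Build
  (measure_tuple_display R.-ocitv.-measurable.-sigma) 'rV[R]_n
  (g_sigma_preimage coord)
  row_set0 row_setC row_bigcup.

End row_measurable.

Lemma measurable_row_coord (R : realType) n (i : 'I_n) :
  measurable_fun setT (fun x : 'rV[R]_n => x ord0 i).
Proof.
move=> _ Y mY; rewrite setTI; apply: sub_sigma_algebra => /=.
rewrite -bigcup_seq/=; exists i => /=; first by rewrite mem_index_enum.
by exists Y => //; rewrite setTI.
Qed.

Lemma measurable_fun_rowP d (T : measurableType d) (R : realType) n
    (f : T -> 'rV[R]_n) :
  (forall i, measurable_fun setT (fun t => f t ord0 i)) -> measurable_fun setT f.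
Proof.
move=> mf.
suff prefS : preimage_set_system setT f
    (g_sigma_preimage (fun (i : 'I_n) (x : 'rV[R]_n) => x ord0 i : R))
    `<=` measurable.
  by move=> _ A mA; apply: prefS; exists A.
rewrite -g_sigma_preimage_comp.
apply: smallest_sub; first exact: sigma_algebra_measurable.
case: n => [|n] in f mf *; first by rewrite big_ord0.
rewrite -bigcup_mkord_ord; apply: bigcup_sub => i Ii.
by move=> A [B mB <-]; exact: mf.
Qed.

Section row_cons.
Context {R : realType} {n : nat}.

Definition row_cons (z : R * 'rV[R]_n) : 'rV[R]_n.+1 :=
  \row_i if unlift ord0 i is Some j then z.2 ord0 j else z.1.

Definition row_uncons (x : 'rV[R]_n.+1) : R * 'rV[R]_n :=
  (x ord0 ord0, \row_j x ord0 (lift ord0 j)).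

Lemma row_consK : cancel row_cons row_uncons.
Proof.
move=> [a v]; rewrite /row_uncons /row_cons; congr pair.
  by rewrite mxE unlift_none.
by apply/rowP => j; rewrite !mxE liftK.
Qed.

Lemma row_unconsK : cancel row_uncons row_cons.
Proof.
move=> x; apply/rowP => i; rewrite mxE.
by case: unliftP => [j ->|->]; rewrite /= ?mxE.
Qed.

Lemma measurable_row_cons : measurable_fun setT row_cons.
Proof.
apply: measurable_fun_rowP => i; rewrite /row_cons.
under eq_fun do rewrite mxE.
case: unliftP => [j _|_]; last exact: measurable_fst.
by apply: (measurableT_comp (measurable_row_coord j)); exact: measurable_snd.
Qed.

Lemma measurable_row_uncons : measurable_fun setT row_uncons.
Proof.
apply/measurable_fun_pairP; split; first exact: measurable_row_coord.
apply: measurable_fun_rowP => j /=.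
by under eq_fun do rewrite mxE; exact: measurable_row_coord.
Qed.

End row_cons.

(* Restated because the sigma-finite instance of \x is not found by inference. *)
Lemma product_sigma_finite d1 d2 (T1 : measurableType d1)
    (T2 : measurableType d2) (R : realType)
    (m1 : {sigma_finite_measure set T1 -> \bar R})
    (m2 : {sigma_finite_measure set T2 -> \bar R}) :
  sigma_finite setT (m1 \x m2)%E.
Proof.
have /sigma_finiteP[F [TF ndF Foo]] := sigma_finiteT m1.
have /sigma_finiteP[G [TG ndG Goo]] := sigma_finiteT m2.
exists (fun k => F k `*` G k).
  rewrite -setXTT TF TG predeqE => -[x y]; split.
    move=> [/= [i _ Fix] [j _ Gjy]]; exists (maxn i j) => //; split.
    - by move: x Fix; exact/subsetPset/ndF/leq_maxl.
    - by move: y Gjy; exact/subsetPset/ndG/leq_maxr.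
  by move=> [i _ []/= ? ?]; split; exists i.
move=> k; have [? ?] := Foo k; have [? ?] := Goo k.
split; first exact: measurableX.
by rewrite product_measure1E// lte_mul_pinfty// ge0_fin_numE.
Qed.

Section lebesgue_step.
Context {R : realType} {n : nat}.
Variable mu : {sigma_finite_measure set 'rV[R]_n -> \bar R}.
Local Open Scope ereal_scope.

Definition lebesgue_step : set 'rV[R]_n.+1 -> \bar R :=
  pushforward ((@lebesgue_measure R) \x mu) row_cons.

Let step0 : lebesgue_step set0 = 0.
Proof. by rewrite /lebesgue_step /pushforward preimage_set0 measure0. Qed.

Let step_ge0 A : 0 <= lebesgue_step A.
Proof. by rewrite /lebesgue_step /pushforward; exact: measure_ge0. Qed.

Let step_sigma_additive : semi_sigma_additive lebesgue_step.
Proof.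
move=> F mF tF mUF; rewrite /lebesgue_step /pushforward preimage_bigcup.
have mp A : measurable A -> measurable (row_cons @^-1` A : set (R * 'rV[R]_n)).
  by move=> mA; rewrite -[X in measurable X]setTI; exact: measurable_row_cons.
apply: measure_semi_sigma_additive.
- by move=> k; exact: mp.
- apply/trivIsetP => /= i j _ _ ij; rewrite -preimage_setI.
  by move/trivIsetP : tF => /(_ _ _ _ _ ij) ->//; rewrite preimage_set0.
- by rewrite -preimage_bigcup; exact: mp.
Qed.

HB.instance Definition _ := isMeasure.Build _ _ _
  lebesgue_step step0 step_ge0 step_sigma_additive.

Let step_sigma_finite : sigma_finite setT lebesgue_step.
Proof.
have [F FT Foo] := product_sigma_finite
  [the {sigma_finite_measure set _ -> \bar R} of @lebesgue_measure R] mu.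
exists (fun k => row_uncons @^-1` F k).
  by rewrite -preimage_bigcup -FT preimage_setT.
move=> k; have [mF Fk] := Foo k; split.
  by rewrite -[X in measurable X]setTI; exact: measurable_row_uncons.
rewrite /lebesgue_step /pushforward -comp_preimage.
rewrite (_ : _ \o _ = id) ?preimage_id//.
by apply/funext => z /=; rewrite row_consK.
Qed.

HB.instance Definition _ := Measure_isSigmaFinite.Build _ _ _
  lebesgue_step step_sigma_finite.

End lebesgue_step.

(* Lebesgue measure on R^n, as an iterated product. *)
Fixpoint lebesgue_row {R : realType} (n : nat) :
    {sigma_finite_measure set 'rV[R]_n -> \bar R} :=
  match n with
  | 0 => \d_(0 : 'rV[R]_0)
  | n'.+1 => lebesgue_step (lebesgue_row n')
  end.

Section calculus.
Context {R : realType} {n : nat}.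
Implicit Types (v w : 'rV[R]_n) (f u : 'rV[R]_n -> R) (g : 'rV[R]_n -> 'rV[R]_n).
Implicit Types (Omega : set 'rV[R]_n) (p : R).

Definition dotv v w : R := \sum_(i < n) v ord0 i * w ord0 i.

(* The library norm `|v| on 'rV[R]_n is the sup norm. *)
Definition enorm v : R := Num.sqrt (dotv v v).

Definition partial (i : 'I_n) f : 'rV[R]_n -> R := 'D_(delta_mx ord0 i) f.

Definition gradient f (x : 'rV[R]_n) : 'rV[R]_n := \row_i partial i f x.

(* C^oo: all iterated partial derivatives exist and are continuous. *)
Definition smooth f : Prop :=
  forall s : seq 'I_n,
    continuous (foldr partial f s) /\
    forall i x, derivable (foldr partial f s) x (delta_mx ord0 i).

Definition test_function Omega f : Prop :=
  smooth f /\
  exists K, [/\ compact K, K `<=` Omega & forall x, ~ K x -> f x = 0].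

Definition bounded_domain Omega : Prop :=
  [/\ open Omega, Omega !=set0, connected Omega & bounded_set Omega].

(* Around each boundary point Omega is the sublevel set {rho < 0} of a C^1
   function with non-vanishing gradient; by the implicit function theorem this
   says that Omega lies locally on one side of a C^1 graph. *)
Definition C1_boundary Omega : Prop :=
  forall x, (closure Omega `\` interior Omega) x ->
  exists (U : set 'rV[R]_n) (rho : 'rV[R]_n -> R),
    [/\ open_nbhs x U,
        forall y i, U y -> derivable rho y (delta_mx ord0 i) /\
                           {for y, continuous (partial i rho)},
        forall y, U y -> gradient rho y != 0 &
        Omega `&` U = [set y | rho y < 0] `&` U].

Definition Lp_norm Omega p f : \bar R :=
  poweR (\int[lebesgue_row n]_(x in Omega) (powR `|f x| p)%:E)%E p^-1.

Definition weak_gradient Omega u g : Prop :=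
  forall phi i, test_function Omega phi ->
    (\int[lebesgue_row n]_(x in Omega) (u x * partial i phi x)%:E =
     - \int[lebesgue_row n]_(x in Omega) (g x ord0 i * phi x)%:E)%E.

(* u is in W^{1,p}(Omega), with weak gradient g. *)
Definition W1p Omega p u g : Prop :=
  [/\ measurable_fun Omega u /\ measurable_fun Omega g,
      (Lp_norm Omega p u < +oo)%E,
      (Lp_norm Omega p (enorm \o g) < +oo)%E &
      weak_gradient Omega u g].

Definition sobolev_norm Omega p u g : \bar R :=
  poweR (\int[lebesgue_row n]_(x in Omega) (powR `|u x| p)%:E +
         \int[lebesgue_row n]_(x in Omega) (powR (enorm (g x)) p)%:E)%E p^-1.

(* W_0^{1,p}(Omega), the closure of the test functions in W^{1,p}(Omega).  An
   element is given by a representative together with a representative of its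
   weak gradient, which is unique up to null sets. *)
Record W01p Omega p := {
  W01p_fun :> 'rV[R]_n -> R ;
  nabla : 'rV[R]_n -> 'rV[R]_n ;
  W01p_W1p : W1p Omega p W01p_fun nabla ;
  W01p_closure : exists phi : nat -> 'rV[R]_n -> R,
    (forall k, test_function Omega (phi k)) /\
    (fun k => sobolev_norm Omega p (phi k \- W01p_fun)
                                   (gradient (phi k) \- nabla)) @ \oo --> 0%E }.

End calculus.

Section eigenvalue.
Context {R : realType} {n : nat} {Omega : set 'rV[R]_n} {p : R}.
Local Notation W := (W01p Omega p).
Local Open Scope ereal_scope.

Definition nonzero (u : W) : Prop :=
  ~ {ae lebesgue_row n, forall x, Omega x -> u x = 0%R}.

Definition unit_sphere : set W := [set u : W | sobolev_norm Omega p u (nabla u) = 1].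

(* An operator F from W_0^{1,p} to its dual is given by the values
   F u w = <F(u), w>.  Quotients with <G(u), u> = 0 < <F(u), u> are +oo. *)
Definition quotients (F G : W -> W -> \bar R) : set (\bar R) :=
  [set F u u / G u u | u in [set u : W | nonzero u]].

Definition first_eigenvalue (F G : W -> W -> \bar R) : \bar R :=
  ereal_inf (quotients F G).

Definition first_eigenvalue_root (F G : W -> W -> \bar R) : \bar R :=
  ereal_inf [set poweR r p^-1 | r in quotients F G].

(* - div (|grad u|^(p-2) grad u), in weak form *)
Definition minus_plaplacian (u w : W) : \bar R :=
  \int[lebesgue_row n]_(x in Omega)
    (powR (enorm (nabla u x)) (p - 2) * dotv (nabla u x) (nabla w x))%:E.

(* |u|^(p0-2) u |grad u|^p1.  For p0 < 2 the factor |u|^(p0-2) is singular where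
   u = 0; there powR 0 (p0 - 2) = 0, and for p0 = 0 this is immaterial because
   grad u = 0 almost everywhere on {u = 0}. *)
Definition mixed_operator (p0 p1 : R) (u w : W) : \bar R :=
  \int[lebesgue_row n]_(x in Omega)
    (powR `|u x| (p0 - 2) * u x * powR (enorm (nabla u x)) p1 * w x)%:E.

(* - div (|u|^(p-2) grad u), in weak form *)
Definition porous_operator (u w : W) : \bar R :=
  \int[lebesgue_row n]_(x in Omega)
    (powR `|u x| (p - 2) * dotv (nabla u x) (nabla w x))%:E.

Definition power_operator (u w : W) : \bar R :=
  \int[lebesgue_row n]_(x in Omega) (powR `|u x| (p - 2) * u x * w x)%:E.

End eigenvalue.

Definition lambda1_laplacian {R : realType} {n : nat} (Omega : set 'rV[R]_n) :
    \bar R :=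
  ereal_inf [set (Lp_norm Omega 2 (enorm \o nabla v) / Lp_norm Omega 2 v)%E
            | v in [set v : W01p Omega 2 | nonzero v]].

(* Main.v *)
Require Import Defs.
From mathcomp Require Import all_boot all_order all_algebra.
From mathcomp Require Import all_classical all_reals all_analysis.
From mathcomp Require Import measurable_realfun.
From mathcomp Require Import ring lra.
Import Order.TTheory GRing.Theory Num.Theory.
Import numFieldNormedType.Exports.

(** The mixed operator. With [G u = int |u|^a |grad u|^b] and [a + b = p], both infima
    are taken over quotients [||grad u||_p / G(u)^(1/p)], once over the non-zero
    elements of W_0^{1,p} and once over its unit sphere. Numerator and denominator are
    homogeneous of degree 1, so multiplying by a constant moves a non-zero element to
    the sphere without changing its quotient ([normalise]). The two sets of quotients
    can differ only in degenerate cases: elements of the sphere that vanish almost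
    everywhere have quotient [+oo] if [a > 0]; and if [a = 0], the operator integrates
    the power of the gradient over the set where [u] does not vanish only, but then a
    smooth bump function, whose gradient vanishes wherever the function does, has the
    quotient 1 in both senses ([mixed_eigenvalue]). The common infimum is a real
    number because the quotients are non-negative and that of the bump function is
    finite.

    The porous operator. Formally the substitution [v = |u|^(p/2 - 1) u] turns [int
    |u|^p] into [int v^2] and [int |u|^(p-2) |grad u|^2] into [(2/p)^2 int |grad
    v|^2], which gives the formula. The power need not be smooth at 0 and its inverse has
    an unbounded derivative there, so the substitution is not carried out in Sobolev
    spaces. Instead, the lower bounds of the two quotients are written as inequalities
    between integrals, and
    - for test functions the inequality of exponent 2 implies that of exponent [p] and
      conversely ([energy_bound_transfer]): [phi (phi^2 + e)^g] is again a test
      function, and dominated convergence gives the limit [e -> 0];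
    - an inequality for test functions extends to W_0^{1,p} by density
      ([energy_bound_W01p]). The energy [int |u|^(p-2) |grad u|^2] is controlled there
      by a pointwise inequality for powers ([powR_mul2_perturb]).

    Both eigenvalues need that test functions are elements of W_0^{1,p}
    ([W01p_of_test]), that is, integration by parts on R^n, which follows from
    Fubini's theorem and the fundamental theorem of calculus ([int_partial_eq0]); and
    that there are test functions that do not vanish ([exists_bump]), by the usual
    construction from [exp (-1/t)]. *)

Set Implicit Arguments.
Unset Strict Implicit.
Unset Printing Implicit Defensive.
Local Open Scope classical_set_scope.
Local Open Scope ring_scope.

(** * Directional derivatives and flat functions *)

Section directional.
Context {R : realType} {V : normedModType R}.
Implicit Types (f g : V -> R) (h : R -> R) (x v : V).

(** Turns directional derivatives into one-variable derivatives along a line; the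
    chain rule below and the derivatives of coordinate slices come from it. *)
Lemma is_derive_along f x v df :
  is_derive x v f df <-> is_derive (0 : R) 1 (fun t : R => f (t *: v + x)) df.
Proof.
have E : 'D_v f x = 'D_1 (fun t : R => f (t *: v + x)) 0.
  rewrite /derive; set g1 := fun t : R => t^-1 *: _;
  set g2 := fun t : R => t^-1 *: _.
  suff -> : g1 = g2 by []; apply/funext => t; rewrite /g1 /g2 /=.
  by rewrite addr0 scale0r add0r [_%:A]mulr1.
split=> -[D V_].
  by split; [exact: (iffLR (derivable1P _ _ _) D)|exact: etrans (esym E) V_].
by split; [exact: (iffRL (derivable1P _ _ _) D)|exact: etrans E V_].
Qed.

Lemma is_derive_comp1 f h x v df dh :
  is_derive x v f df -> is_derive (f x) 1 h dh ->
  is_derive x v (h \o f) (dh * df).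
Proof.
move=> /is_derive_along Df Dh; apply/is_derive_along.
apply: (@is_derive1_comp _ h (fun t : R => f (t *: v + x))) => //=.
by rewrite scale0r add0r.
Qed.

End directional.

Section flat_functions.
Context {R : realType}.
Implicit Types (t : R) (k : nat).

(** [t^-k exp (-1/t)] extended by 0: the whole family is needed because, unlike
    [exp (-1/t)] alone, it is closed under differentiation up to linear combinations. *)
Definition flat k t : R := if 0 < t then t^-1 ^+ k * expR (- t^-1) else 0.

Lemma flat_gt0 k t : 0 < t -> 0 < flat k t.
Proof. by move=> t0; rewrite /flat t0 mulr_gt0 ?expR_gt0// exprn_gt0// invr_gt0. Qed.

Lemma flat_eq0 k t : t <= 0 -> flat k t = 0.
Proof. by move=> t0; rewrite /flat ltNge t0. Qed.

(** The exponential dominates its Taylor term of degree [k.+1], that is,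
    [exp (1/t) >= t^-(k+1) / (k+1)!]. Applied to [k.+1], this gives the vanishing
    derivative of [flat k] at 0. *)
Lemma flat_le k t : flat k t <= k.+1`!%:R * `|t|.
Proof.
rewrite /flat; case: ifP => [t0|_]; last by rewrite mulr_ge0.
have i0 : 0 < t^-1 by rewrite invr_gt0.
rewrite expRN ler_pdivrMr ?expR_gt0// gtr0_norm//.
have e1 : t^-1 ^+ k.+1 / k.+1`!%:R <= expR t^-1.
  by apply: le_trans (expR_ge1Dxn k (ltW i0)); rewrite lerDr.
have f0 : (0 : R) < k.+1`!%:R by rewrite ltr0n fact_gt0.
apply: le_trans (ler_wpM2l _ e1); last by rewrite mulr_ge0// ltW.
rewrite exprS [leRHS](_ : _ = t^-1 ^+ k)//.
by field; rewrite !gt_eqF.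
Qed.

Lemma is_derive_flat k t :
  is_derive t 1 (flat k) (flat k.+2 t - k%:R * flat k.+1 t).
Proof.
have [t0|t0|->] := ltgtP t 0.
- rewrite !flat_eq0 ?(ltW t0)// mulr0 subr0.
  apply: (@near_eq_is_derive _ _ _ (cst 0)).
  by near=> x; rewrite flat_eq0//; apply: ltW; near: x; exact: lt_nbhsl.
- have Di : is_derive t 1 (@GRing.inv R) (- t^-2 * 1).
    have tn : t != 0 by rewrite gt_eqF.
    split; first exact: (@derivableV _ _ (@id R) t 1 tn).
    by rewrite (@deriveV _ _ (@id R)) ?gt_eqF// derive_id [_ *: _]mulr1 mulr1.
  have De : is_derive t^-1 1 (fun x => x ^+ k * expR (- x))
      ((k%:R * t^-1 ^+ k.-1 - t^-1 ^+ k) * expR (- t^-1)).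
    have Dx : is_derive t^-1 1 (fun x : R => x ^+ k) (k%:R * t^-1 ^+ k.-1).
      have := is_deriveX k (is_derive_id t^-1 (1 : R)).
      by rewrite exprfctE [_ *: _]mulr1.
    have Dn : is_derive t^-1 1 (fun x : R => expR (- x)) (expR (- t^-1) * - 1).
      exact: (is_derive1_comp (f := expR)).
    apply: (is_derive_eq (f := (fun x : R => x ^+ k) * (fun x => expR (- x)))).
    by rewrite /GRing.scale/=; ring.
  have := is_derive_eq (is_derive_comp1 Di De).
  move=> /(_ (flat k.+2 t - k%:R * flat k.+1 t)) D.
  apply: near_eq_is_derive (D _).
    by near=> x; rewrite /flat ifT//; near: x; exact: lt_nbhsr.
  rewrite /flat t0 -exprVn; move: (t^-1) => y; case: (k) => [|m] /=.
    by ring.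
  by rewrite !exprS; ring.
- rewrite !flat_eq0// mulr0 subr0.
  have L : (fun x : R => x^-1 *: ((flat k \o shift 0) (x *: 1) - flat k 0))
      @ 0^' --> (0 : R).
    apply/cvgr0Pnorm_le => e e0; near=> x.
    rewrite /= [flat k 0]flat_eq0// subr0 addr0 [_ *: 1]mulr1.
    have x0 : x != 0 by near: x; exact: nbhs_dnbhs_neq.
    have f0 : (0 : R) < k.+2`!%:R by rewrite ltr0n fact_gt0.
    apply: (@le_trans _ _ (k.+2`!%:R * `|x|)).
      apply: le_trans (flat_le _ _).
      rewrite /flat; case: ifP => x1; last by rewrite scaler0 normr0.
      rewrite ger0_norm ?exprS ?[_ *: _]mulrA// mulr_ge0 ?expR_ge0//.
      by rewrite -exprS exprn_ge0// invr_ge0 ltW.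
    rewrite -ler_pdivlMl//; near: x.
    apply: dnbhs0_le; by rewrite mulr_gt0// invr_gt0.
  split; first by apply/cvg_ex; exists 0.
  exact: cvg_lim.
Unshelve. all: by end_near. Qed.

End flat_functions.

(** * Smooth functions and test functions *)

Section smooth_functions.
Context {R : realType} {n : nat}.
Implicit Types (f g phi : 'rV[R]_n -> R) (i : 'I_n) (k : nat) (x : 'rV[R]_n).

Local Notation e i := (delta_mx ord0 i : 'rV[R]_n).

(** Counting the derivatives, instead of quantifying over words of them as [smooth]
    does, makes closure under products and compositions provable by induction. *)
Fixpoint Ck k f : Prop :=
  continuous f /\
  if k is k'.+1 then
    forall i, (forall x, derivable f x (e i)) /\ Ck k' (partial i f)
  else True.

Lemma Ck_continuous k f : Ck k f -> continuous f.
Proof. by case: k => [|k] []. Qed.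

Lemma Ck_is_derive k f i x : Ck k.+1 f -> is_derive x (e i) f (partial i f x).
Proof. by case=> _ /(_ i)[+ _]; split. Qed.

Lemma Ck_partial k f i : Ck k.+1 f -> Ck k (partial i f).
Proof. by case=> _ /(_ i)[]. Qed.

Lemma CkS k f : continuous f ->
  (forall i, exists2 g, (forall x, is_derive x (e i) f (g x)) & Ck k g) ->
  Ck k.+1 f.
Proof.
move=> cf df; split=> // i; have [g dg cg] := df i.
split=> [x|]; first by case: (dg x).
suff -> : partial i f = g by [].
by apply/funext => x; case: (dg x).
Qed.

Lemma CkW k f : Ck k.+1 f -> Ck k f.
Proof.
elim: k f => [|k IH] f [cf df]; split=> // i.
by have [d c] := df i; split=> //; exact: IH.
Qed.

(** The innermost letter of a word of derivatives is split off, since it is the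
    derivative that [Ck] takes first. *)
Lemma smoothP f : smooth f <-> forall k, Ck k f.
Proof.
split=> [sf k|cf s].
  elim: k f sf => [|k IH] f sf; first by split=> //; case: (sf [::]).
  split; first by case: (sf [::]).
  move=> i; split; first by case: (sf [::]).
  by apply: IH => s; have := sf (rcons s i); rewrite foldr_rcons.
elim/last_ind: s f cf => [|s i IH] f cf.
  by have [c d] := cf 1%N; split=> // i; case: (d i).
by rewrite foldr_rcons; apply: IH => k; exact: Ck_partial (cf k.+1).
Qed.

Lemma Ck_cst k (c : R) : Ck k (fun=> c).
Proof.
elim: k c => [|k IH] c; first by split=> //; exact: cst_continuous.
apply: CkS; first exact: cst_continuous.
by move=> i; exists (fun=> 0) => // x; exact: is_derive_cst.
Qed.

Lemma CkD k f g : Ck k f -> Ck k g -> Ck k (fun x => f x + g x).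
Proof.
elim: k f g => [|k IH] f g cf cg.
  by split=> // x; apply: (@cvgD _ _ _ (nbhs x));
    [exact: (Ck_continuous cf)|exact: (Ck_continuous cg)].
apply: CkS => [|i].
  by move=> x; apply: (@cvgD _ _ _ (nbhs x));
    [exact: (Ck_continuous cf)|exact: (Ck_continuous cg)].
exists (fun x => partial i f x + partial i g x); last first.
  by apply: IH; [exact: (Ck_partial i cf)|exact: (Ck_partial i cg)].
by move=> x; apply: is_deriveD;
  [exact: (Ck_is_derive i x cf)|exact: (Ck_is_derive i x cg)].
Qed.

Lemma CkM k f g : Ck k f -> Ck k g -> Ck k (fun x => f x * g x).
Proof.
elim: k f g => [|k IH] f g cf cg.
  by split=> // x; apply: (@cvgM _ _ (nbhs x));
    [exact: (Ck_continuous cf)|exact: (Ck_continuous cg)].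
apply: CkS => [|i].
  by move=> x; apply: (@cvgM _ _ (nbhs x));
    [exact: (Ck_continuous cf)|exact: (Ck_continuous cg)].
exists (fun x => f x * partial i g x + g x * partial i f x); last first.
  apply: CkD; apply: IH.
  exact: (CkW cf).
  exact: (Ck_partial i cg).
  exact: (CkW cg).
  exact: (Ck_partial i cf).
by move=> x; apply: is_deriveM;
  [exact: (Ck_is_derive i x cf)|exact: (Ck_is_derive i x cg)].
Qed.

Lemma Ck_sum k (s : seq 'I_n) (f : 'I_n -> 'rV[R]_n -> R) :
  (forall i, Ck k (f i)) -> Ck k (fun x => \sum_(i <- s) f i x).
Proof.
move=> cf; elim: s => [|i s IH].
  by under eq_fun do rewrite big_nil; exact: Ck_cst.
by under eq_fun do rewrite big_cons; exact: CkD.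
Qed.

Lemma is_derive_coord (i j : 'I_n) x :
  is_derive x (e i) (fun y : 'rV[R]_n => y ord0 j) ((i == j)%:R : R).
Proof.
apply/is_derive_along.
have -> : (fun t : R => (t *: e i + x) ord0 j) =
    (fun t => t * (i == j)%:R + x ord0 j).
  by apply/funext => t; rewrite !mxE eqxx/= eq_sym.
have H := is_deriveD (is_deriveM (is_derive_id (0 : R) 1)
  (is_derive_cst ((i == j)%:R : R) (0 : R) 1)) (is_derive_cst (x ord0 j) (0 : R) 1).
apply: (is_derive_eq H).
by rewrite scale0r add0r addr0 [LHS]mulr1.
Qed.

Lemma Ck_coord k (j : 'I_n) : Ck k (fun x : 'rV[R]_n => x ord0 j).
Proof.
case: k => [|k]; first by split=> //; exact: coord_continuous.
apply: CkS => [|i]; first exact: coord_continuous.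
exists (fun=> (i == j)%:R); last exact: Ck_cst.
by move=> x; exact: is_derive_coord.
Qed.

(** The derivative of [flat j (f x)] involves [flat] of higher index, so the
    induction on [k] runs over all [j] at once. *)
Lemma Ck_flat k (j : nat) f : Ck k f -> Ck k (fun x => flat j (f x)).
Proof.
have cfl (l : nat) : continuous (@flat R l).
  move=> t; apply/differentiable_continuous/derivable1_diffP.
  by case: (is_derive_flat l t).
have cc l f' : continuous f' -> continuous (fun x => flat l (f' x)).
  by move=> c x; apply: continuous_comp; [exact: c|exact: cfl].
elim: k j f => [|k IH] j f cf.
  by split=> //; apply: cc; exact: Ck_continuous cf.
apply: CkS => [|i]; first by apply: cc; exact: Ck_continuous cf.
exists (fun x => (flat j.+2 (f x) + - j%:R * flat j.+1 (f x)) * partial i f x).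
  move=> x; rewrite mulNr; apply: is_derive_comp1;
    first exact: (Ck_is_derive i x cf).
  exact: is_derive_flat.
apply: CkM; last exact: (Ck_partial i cf).
have cf' := CkW cf.
apply: CkD; first exact: IH.
apply: CkM; [exact: Ck_cst|exact: IH].
Qed.

(** Same scheme as for [flat]: differentiation lowers the exponent, so the
    exponent is generalised in the induction. *)
Lemma Ck_powR k (a : R) f : (forall x, 0 < f x) -> Ck k f ->
  Ck k (fun x => powR (f x) a).
Proof.
move=> f0.
have cc b : continuous f -> continuous (fun x => powR (f x) b).
  move=> c x; apply: (@continuous_comp _ _ _ f (fun t => powR t b)); first exact: c.
  apply/differentiable_continuous/derivable1_diffP.
  by case: (is_derive1_powR b (f0 x)).
elim: k a => [|k IH] a cf.
  by split=> //; apply: cc; exact: Ck_continuous cf.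
apply: CkS => [|i]; first by apply: cc; exact: Ck_continuous cf.
exists (fun x => (a * powR (f x) (a - 1)) * partial i f x).
  move=> x; apply: (is_derive_comp1 (h := fun t => powR t a));
    first exact: (Ck_is_derive i x cf).
  exact: is_derive1_powR.
apply: CkM; last exact: (Ck_partial i cf).
apply: CkM; [exact: Ck_cst|apply: IH; exact: (CkW cf)].
Qed.

Lemma smooth_partial f i : smooth f -> smooth (partial i f).
Proof. by move=> /smoothP sf; apply/smoothP => k; exact: Ck_partial (sf k.+1). Qed.

Lemma smooth_continuous f : smooth f -> continuous f.
Proof. by case/(_ [::]). Qed.

Lemma smooth_is_derive f i x : smooth f -> is_derive x (e i) f (partial i f x).
Proof. by move=> /smoothP/(_ 1%N)/Ck_is_derive; exact. Qed.

Lemma smoothM f g : smooth f -> smooth g -> smooth (fun x => f x * g x).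
Proof. by move=> /smoothP sf /smoothP sg; apply/smoothP => k; exact: CkM. Qed.

Lemma smooth_cst (c : R) : smooth (fun _ : 'rV[R]_n => c).
Proof. by apply/smoothP => k; exact: Ck_cst. Qed.

End smooth_functions.

Section test_functions.
Context {R : realType} {n : nat} (Omega : set 'rV[R]_n).
Implicit Types (f g phi psi : 'rV[R]_n -> R) (i : 'I_n) (x : 'rV[R]_n).

Lemma test_smooth phi : test_function Omega phi -> smooth phi.
Proof. by case. Qed.

Lemma partial_eq0_out (K : set 'rV[R]_n) phi i x : closed K ->
  (forall y, ~ K y -> phi y = 0) -> ~ K x -> partial i phi x = 0.
Proof.
move=> cK phi0 Kx; rewrite /partial.
rewrite (@near_eq_derive _ _ _ _ (cst 0)) ?derive_cst//.
have : nbhs x (~` K) by apply: open_nbhs_nbhs; split => //; exact: closed_openC.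
by apply: filterS => y /phi0.
Qed.

Lemma test_partial phi i : test_function Omega phi ->
  test_function Omega (partial i phi).
Proof.
case=> sphi [K [cK KO phi0]]; split; first exact: smooth_partial.
exists K; split=> // x; apply: partial_eq0_out => //.
by apply: compact_closed => //; exact: norm_hausdorff.
Qed.

Lemma test_mulr phi f : test_function Omega phi -> smooth f ->
  test_function Omega (fun x => phi x * f x).
Proof.
case=> sphi [K [cK KO phi0]] sf; split; first exact: smoothM.
by exists K; split=> // x /phi0->; rewrite mul0r.
Qed.

Lemma test_out phi x : test_function Omega phi -> ~ Omega x -> phi x = 0.
Proof. by case=> _ [K [_ KO phi0]] Ox; apply: phi0 => /KO. Qed.

Lemma compact_support_bounded (K : set 'rV[R]_n) f : compact K -> continuous f ->
  (forall x, ~ K x -> f x = 0) -> exists2 M, 0 < M & forall x, `|f x| <= M.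
Proof.
move=> cK cf f0.
have : compact (f @` K).
  by apply: continuous_compact => //; exact: continuous_subspaceT.
move=> /compact_bounded[M [Mr MP]].
exists (`|M| + 1) => [|x]; first by rewrite ltr_wpDl.
have [Kx|/f0->] := pselect (K x); last by rewrite normr0 addr_ge0.
by apply: MP; [rewrite (le_lt_trans (ler_norm M))// ltrDl|exists x].
Qed.

Lemma test_bounded phi : test_function Omega phi ->
  exists2 M, 0 < M & forall x, `|phi x| <= M.
Proof.
by case=> sphi [K [cK KO phi0]]; apply: (compact_support_bounded cK) => //;
  exact: smooth_continuous.
Qed.

Lemma partialZ f (c : R) i x : smooth f ->
  partial i (fun y => c * f y) x = c * partial i f x.
Proof.
move=> sf; have D := smooth_is_derive i x sf.
have := is_deriveZ c D; case=> _ E; exact: E.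
Qed.

Lemma partialM f g i x : smooth f -> smooth g ->
  partial i (fun y => f y * g y) x = f x * partial i g x + g x * partial i f x.
Proof.
move=> sf sg; have D := smooth_is_derive i x sf; have D' := smooth_is_derive i x sg.
have := is_deriveM D D'; case=> _ E; exact: E.
Qed.

End test_functions.

(** * Boxes and Borel sets *)

Section boxes.
Context {R : realType}.

Definition box n (c : 'rV[R]_n) (r : R) : set 'rV[R]_n :=
  [set x | forall i, `|x ord0 i - c ord0 i| < r].

Lemma measurable_box n (c : 'rV[R]_n) r : measurable (box c r).
Proof.
have -> : box c r = \bigcap_(i in [set: 'I_n])
    ((fun x : 'rV[R]_n => x ord0 i) @^-1` [set t | `|t - c ord0 i| < r]).
  by rewrite predeqE => x; split=> [bx i _|bx i]; exact: bx.
apply: fin_bigcap_measurable => [|i _]; first exact: finite_finset.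
rewrite -[X in measurable X]setTI; apply: measurable_row_coord => //.
have -> : [set t | `|t - c ord0 i| < r] = `](c ord0 i - r), (c ord0 i + r)[%classic.
  by rewrite predeqE => t; rewrite /= in_itv/= ltr_distl.
exact: measurable_itv.
Qed.

Lemma box_ball n (c : 'rV[R]_n) r : 0 < r -> box c r = ball c r.
Proof.
move=> r0; rewrite predeqE => x; split=> [bx|[_ bx] i].
  by split=> // i j; rewrite (ord1 i) /ball/= distrC; exact: bx.
by rewrite distrC; exact: bx.
Qed.

(** This fixes the two facts about the measure of R^n that the rest relies on:
    bounded sets have finite measure and non-empty open sets have positive measure. *)
Lemma lebesgue_row_box n (c : 'rV[R]_n) r : 0 < r ->
  lebesgue_row n (box c r) = ((r *+ 2) ^+ n)%:E.
Proof.
move=> r0; elim: n c => [|n IH] c.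
  by rewrite expr0 /= diracE mem_set//; case.
have -> : lebesgue_row n.+1 (box c r) =
  (lebesgue_measure \x lebesgue_row n)%E (row_cons @^-1` (box c r)) by [].
have -> : row_cons @^-1` (box c r) =
    [set t | `|t - c ord0 ord0| < r] `*` box (row_uncons c).2 r.
  rewrite predeqE => -[t y]; split=> [bx|[/= b0 b1] i].
    split=> /= [|j]; first by have := bx ord0; rewrite mxE unlift_none.
    by have := bx (lift ord0 j); rewrite !mxE liftK.
  rewrite mxE; case: unliftP => [j ->|->] //=.
  by have := b1 j; rewrite !mxE.
have -> : [set t | `|t - c ord0 ord0| < r] =
    `](c ord0 ord0 - r), (c ord0 ord0 + r)[%classic.
  by rewrite predeqE => t; rewrite /= in_itv/= ltr_distl.
rewrite product_measure1E ?IH//; last exact: measurable_box.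
transitivity ((r *+ 2)%:E * ((r *+ 2) ^+ n)%:E)%E; last by rewrite -EFinM exprS.
congr (_ * _)%E.
have := lebesgue_measure_itv `](c ord0 ord0 - r), (c ord0 ord0 + r)[.
rewrite /= lte_fin ltrD2l gtrN// -EFinD => L.
by apply: (etrans L); congr EFin; ring.
Qed.

Lemma lebesgue_row_box_lty n r : (lebesgue_row n (box (0 : 'rV[R]_n) r) < +oo)%E.
Proof.
have [r0|r0] := ltP 0 r; first by rewrite lebesgue_row_box// ltry.
have b0 : box (0 : 'rV[R]_n) r `<=` box 0 1.
  by move=> x bx i; rewrite (lt_trans (bx i))// (le_lt_trans r0).
apply: (@le_lt_trans _ _ (lebesgue_row n (box (0 : 'rV[R]_n) 1))).
  by apply: le_measure => //; rewrite inE; exact: measurable_box.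
by rewrite lebesgue_row_box// ltry.
Qed.

(** The measurable sets are generated by the coordinates, so openness has to be
    reached by a countable operation: an open set is the union of the boxes with
    rational centre and radius [1/(k+1)] that it contains. *)
Lemma open_measurable_row n (A : set 'rV[R]_n) : open A -> measurable A.
Proof.
move=> oA.
pose B (z : 'rV[rat]_n * nat) := box (map_mx ratr z.1) z.2.+1%:R^-1 : set 'rV[R]_n.
pose C z := if pselect (B z `<=` A) then B z else set0.
have -> : A = \bigcup_z C z.
  rewrite predeqE => x; split=> [Ax|[z _]]; last first.
    by rewrite /C; case: pselect => // BA /BA.
  have : nbhs x A by exact: open_nbhs_nbhs.
  move=> /nbhs_ballP[e /= e0 eA].
  have e20 : 0 < e / 2 by rewrite divr_gt0.
  have [k _ /(_ k (leqnn k))/= ke] := near_infty_natSinv_lt (PosNum e20).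
  have k0 : (0 : R) < k.+1%:R^-1 by rewrite invr_gt0.
  have /choice[q Hq] : forall i : 'I_n, exists q : rat,
      `|x ord0 i - ratr q| < k.+1%:R^-1.
    move=> i.
    have [|q] := @rat_in_itvoo _ (x ord0 i - k.+1%:R^-1) (x ord0 i + k.+1%:R^-1).
      by rewrite ltrD2l gtrN.
    by rewrite in_itv/= -ltr_distl distrC => Hq; exists q.
  exists (\row_i q i, k) => //; rewrite /C; case: pselect => [_ i|].
    by rewrite !mxE; exact: Hq.
  case=> y By; apply: eA; rewrite -box_ball// => i.
  have := By i; have := Hq i; rewrite !mxE/= => h1 h2.
  rewrite [e]splitr; apply: le_lt_trans (ltrD (lt_trans h2 ke) (lt_trans h1 ke)).
  rewrite [`|x _ _ - _|]distrC.
  apply: le_trans (ler_normD _ _).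
  by rewrite addrA subrK.
apply: countable_bigcupT_measurable => [|z].
  exact: countableP.
rewrite /C; case: pselect => [?|?]; [exact: (@measurable_box n)|exact: measurable0].
Qed.

Lemma continuous_measurable_row n (f : 'rV[R]_n -> R) :
  continuous f -> measurable_fun setT f.
Proof.
move=> /continuousP cf; apply: (measurability _ (RGenOpens.measurableE R)).
move=> _ [B [a [b EB]] <-]; rewrite EB setTI; apply: open_measurable_row.
exact/cf/interval_open.
Qed.

End boxes.

(** * The integral of a partial derivative *)

Section parts.
Context {R : realType}.

Lemma int_derive_line (F G : R -> R) (M : R) : 0 < M -> continuous G ->
  (forall t : R, is_derive t (1 : R) F (G t)) ->
  (forall t, M <= `|t| -> F t = 0 /\ G t = 0) ->
  (\int[lebesgue_measure]_t (G t)%:E = 0)%E.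
Proof.
move=> M0 cG dF out.
have cF : continuous F.
  move=> t; apply/differentiable_continuous/derivable1_diffP.
  by case: (dF t).
have -> : (fun t => (G t)%:E) = (EFin \o G) \_ `[- M, M].
  apply/funext => t; rewrite patchE; case: ifPn => //.
  rewrite notin_setE/= in_itv/= => /negP; rewrite -ler_norml -ltNge => /ltW Mt.
  by have [_ ->] := out t Mt.
rewrite -integral_mkcond (@continuous_FTC2 _ G F).
- have [-> _] := out M (ler_norm M).
  have [|-> _] := out (- M); first by rewrite normrN ler_norm.
  by rewrite subee.
- by rewrite gtrN.
- exact: continuous_subspaceT.
- split; first by move=> t _; case: (dF t).
  + exact/cvg_at_right_filter/cF.
  + exact/cvg_at_left_filter/cF.
- by move=> t _; rewrite derive1E; case: (dF t).
Qed.

Lemma integrable_box n (f : 'rV[R]_n -> R) (C M : R) :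
  measurable_fun setT f -> (forall x, `|f x| <= C) ->
  (forall x, ~ box 0 M x -> f x = 0) ->
  (lebesgue_row n).-integrable setT (EFin \o f).
Proof.
move=> mf fC f0.
have mb := @measurable_box R n 0 M.
have -> : EFin \o f = (EFin \o f) \_ (box 0 M).
  apply/funext => x; rewrite patchE; case: ifPn => //.
  by rewrite notin_setE/= => /f0 ->.
apply: (iffLR (integrable_mkcond _ mb)).
apply: (@measurable_bounded_integrable _ _ _ (lebesgue_row n)).
- exact: mb.
- exact: lebesgue_row_box_lty.
- exact: measurable_funS mf.
- by exists C; split; [exact: num_real|] => D CD x _ /=; rewrite (le_trans (fC x))// ltW.
Qed.

Lemma compact_box_bounded n (f : 'rV[R]_n -> R) (M : R) : continuous f ->
  (forall x, ~ box 0 M x -> f x = 0) -> exists C, forall x, `|f x| <= C.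
Proof.
move=> cf f0.
have [||C _ HC] := @compact_support_bounded R n
    [set v : 'rV[R]_n | forall i, v ord0 i \in `[- M, M]] f _ cf; last by exists C.
  apply: (@rV_compact _ _ (fun=> `[- M, M]%classic)) => _.
  exact: segment_compact.
move=> x Kx; apply: f0 => bx; apply: Kx => i.
by have := bx i; rewrite mxE subr0 in_itv/= -ler_norml; exact: ltW.
Qed.

Lemma row_cons_continuousr n (t : R) :
  continuous (fun y : 'rV[R]_n => row_cons (t, y)).
Proof.
move=> y A /nbhs_ballP[e e0 eA]; apply/nbhs_ballP; exists e => // z [_ yz].
apply: eA; split=> // i j; rewrite !mxE; case: unliftP => [k _|_] /=.
  exact: yz.
exact: ballxx.
Qed.

Lemma row_cons_continuousl n (y : 'rV[R]_n) :
  continuous (fun t : R => row_cons (t, y)).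
Proof.
move=> t A /nbhs_ballP[e e0 eA]; apply/nbhs_ballP; exists e => // s ts.
apply: eA; split=> // i j; rewrite !mxE; case: unliftP => [k _|_] //=.
exact: ballxx.
Qed.

Lemma row_cons_shift n (t s : R) (y : 'rV[R]_n) (j : 'I_n) :
  s *: delta_mx ord0 (lift ord0 j) + row_cons (t, y) =
  row_cons (t, s *: delta_mx ord0 j + y).
Proof.
apply/rowP => i; rewrite !mxE; case: unliftP => [k ->|->] /=.
  by rewrite !mxE (inj_eq lift_inj).
by rewrite /= mulr0 add0r.
Qed.

Lemma row_cons_shift0 n (t s : R) (y : 'rV[R]_n) :
  s *: delta_mx ord0 ord0 + row_cons (t, y) = row_cons (s + t, y).
Proof.
apply/rowP => i; rewrite !mxE; case: unliftP => [k ->|->] /=.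
  by rewrite mulr0 add0r.
by rewrite mulr1.
Qed.

Lemma box_row_cons n (M t : R) (y : 'rV[R]_n) :
  box 0 M (row_cons (t, y)) <-> `|t| < M /\ box 0 M y.
Proof.
split=> [b|[b0 b] i].
  split=> [|i].
    by have := b ord0; rewrite !mxE unlift_none subr0.
  by have := b (lift ord0 i); rewrite !mxE liftK.
rewrite !mxE; case: unliftP => [j _|_] /=; last by rewrite subr0.
by have := b j; rewrite mxE.
Qed.

Lemma ge0_integral_step n (mu : {sigma_finite_measure set 'rV[R]_n -> \bar R})
    (f : 'rV[R]_n.+1 -> \bar R) : measurable_fun setT f -> (forall x, 0 <= f x)%E ->
  (\int[lebesgue_step mu]_x f x = \int[lebesgue_measure \x mu]_z f (row_cons z))%E.
Proof.
move=> mf f0.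
transitivity (\int[pushforward (@lebesgue_measure R \x mu)%E (@row_cons R n)]_x f x)%E.
  by [].
rewrite ge0_integral_pushforward//.
exact: measurable_row_cons.
Qed.

Lemma integral_step n (mu : {sigma_finite_measure set 'rV[R]_n -> \bar R})
    (f : 'rV[R]_n.+1 -> \bar R) : measurable_fun setT f ->
  (lebesgue_measure \x mu)%E.-integrable setT (f \o (@row_cons R n)) ->
  (\int[lebesgue_step mu]_x f x = \int[lebesgue_measure \x mu]_z f (row_cons z))%E.
Proof.
move=> mf f0.
transitivity (\int[pushforward (@lebesgue_measure R \x mu)%E (@row_cons R n)]_x f x)%E.
  by [].
rewrite integral_pushforward//.
exact: measurable_row_cons.
Qed.

(** Induction on the dimension with Fubini's theorem. If the derivative is in the
    first coordinate, the inner integral over that coordinate vanishes by the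
    fundamental theorem of calculus; otherwise the inner integral over the remaining
    coordinates vanishes by induction. *)
Lemma int_partial_eq0 n (i : 'I_n) (f g : 'rV[R]_n -> R) (M : R) : 0 < M ->
  continuous f -> continuous g ->
  (forall x, is_derive x (delta_mx ord0 i) f (g x)) ->
  (forall x, ~ box 0 M x -> f x = 0 /\ g x = 0) ->
  (\int[lebesgue_row n]_x (g x)%:E = 0)%E.
Proof.
move=> M0; elim: n i f g => [[]//|n IH] i f g cf cg dfg out.
have mg := continuous_measurable_row cg.
have [C gC] := compact_box_bounded cg (fun x h => (out x h).2).
have ig := integrable_box mg gC (fun x h => (out x h).2).
pose h := EFin \o g \o (@row_cons R n).
have ih : (lebesgue_measure \x lebesgue_row n)%E.-integrable setT h.
  apply/integrableP; split.
    apply/measurable_EFinP; apply: measurableT_comp mg _.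
    exact: measurable_row_cons.
  move/integrableP : ig => [_].
  suff -> : (\int[lebesgue_row n.+1]_x `|(g x)%:E| =
      \int[lebesgue_measure \x lebesgue_row n]_z `|h z|)%E by [].
  apply: (@ge0_integral_step _ (lebesgue_row n) (fun x => `|(g x)%:E|%E)) => //.
  by apply: measurableT_comp => //; exact/measurable_EFinP.
transitivity (\int[lebesgue_measure \x lebesgue_row n]_z (h z))%E.
  apply: (@integral_step _ (lebesgue_row n) (EFin \o g)) => //.
  exact/measurable_EFinP.
case: (unliftP ord0 i) dfg => [j|] -> dfg.
  rewrite -integral12_prod_meas1//.
  rewrite (_ : fubini_F _ _ = cst 0%E) ?integral_cst ?mul0e//.
  apply/funext => t; rewrite /fubini_F.
  apply: (IH j (fun y => f (row_cons (t, y))) (fun y => g (row_cons (t, y)))).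
  - by move=> y; apply: continuous_comp; [exact: row_cons_continuousr|exact: cf].
  - by move=> y; apply: continuous_comp; [exact: row_cons_continuousr|exact: cg].
  - move=> y; have /is_derive_along := dfg (row_cons (t, y)).
    under eq_fun do rewrite row_cons_shift.
    exact: (iffRL (is_derive_along (fun y => f (row_cons (t, y))) _ _ _)).
  - by move=> y by_; apply: out => /box_row_cons[].
rewrite -integral21_prod_meas1//.
rewrite (_ : fubini_G _ _ = cst 0%E) ?integral_cst ?mul0e//.
apply/funext => y; rewrite /fubini_G.
apply: (@int_derive_line (fun t => f (row_cons (t, y)))
  (fun t => g (row_cons (t, y))) M M0).
- by move=> t; apply: continuous_comp; [exact: row_cons_continuousl|exact: cg].
- move=> t; have /is_derive_along := dfg (row_cons (t, y)).
  under eq_fun do rewrite row_cons_shift0 -[X in X + _]mulr1.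
  exact: (iffRL (is_derive_along (fun s => f (row_cons (s, y))) _ _ _)).
- by move=> t Mt; apply: out => /box_row_cons[]; rewrite ltNge Mt.
Qed.

End parts.

(** * The Euclidean norm and integrability in W_0^{1,p} *)

Section euclidean_norm.
Context {R : realType} {n : nat}.
Implicit Types (v w : 'rV[R]_n).

Lemma dotvv_ge0 v : 0 <= dotv v v.
Proof. by apply: sumr_ge0 => i _; rewrite -expr2 sqr_ge0. Qed.

Lemma enorm_ge0 v : 0 <= enorm v.
Proof. exact: sqrtr_ge0. Qed.

Lemma enorm_sqr v : enorm v ^+ 2 = dotv v v.
Proof. by rewrite sqr_sqrtr// dotvv_ge0. Qed.

Lemma enorm0 : enorm (0 : 'rV[R]_n) = 0.
Proof.
by rewrite /enorm /dotv big1 ?sqrtr0// => i _; rewrite mxE mul0r.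
Qed.

Lemma enormZ (c : R) v : enorm (c *: v) = `|c| * enorm v.
Proof.
rewrite /enorm -sqrtr_sqr -sqrtrM ?sqr_ge0//; congr Num.sqrt.
by rewrite /dotv mulr_sumr; apply: eq_bigr => i _; rewrite !mxE; ring.
Qed.

Lemma coord_le_enorm v i : `|v ord0 i| <= enorm v.
Proof.
rewrite /enorm -sqrtr_sqr ler_wsqrtr// /dotv (bigD1 i)//= -expr2 lerDl.
by apply: sumr_ge0 => j _; rewrite -expr2 sqr_ge0.
Qed.

Lemma enorm_eq0 v : enorm v = 0 -> v = 0.
Proof.
move=> v0; apply/rowP => i; rewrite mxE; apply/eqP; rewrite -normr_le0 -v0.
exact: coord_le_enorm.
Qed.

(** Cauchy-Schwarz, by summing [0 <= (|w| v_i - |v| w_i)^2] over the coordinates;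
    the division by [|v| |w|] forces the two degenerate cases. *)
Lemma dotv_le v w : dotv v w <= enorm v * enorm w.
Proof.
have [/enorm_eq0->|v0] := eqVneq (enorm v) 0.
  by rewrite enorm0 mul0r /dotv big1// => i _; rewrite mxE mul0r.
have [/enorm_eq0->|w0] := eqVneq (enorm w) 0.
  by rewrite enorm0 mulr0 /dotv big1// => i _; rewrite mxE mulr0.
have a0 : 0 < enorm v by rewrite lt_neqAle eq_sym v0 enorm_ge0.
have b0 : 0 < enorm w by rewrite lt_neqAle eq_sym w0 enorm_ge0.
have : 2 * (enorm v * enorm w) * dotv v w <=
    enorm w ^+ 2 * dotv v v + enorm v ^+ 2 * dotv w w.
  rewrite /dotv !mulr_sumr -big_split/=; apply: ler_sum => i _.
  rewrite -subr_ge0.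
  have := sqr_ge0 (enorm w * v ord0 i - enorm v * w ord0 i).
  by congr (_ <= _); ring.
rewrite -!enorm_sqr => H; rewrite -(ler_pM2l (mulr_gt0 a0 b0)) -(@ler_pM2l _ 2)//.
by rewrite [leLHS]mulrA (le_trans H)// le_eqVlt; apply/orP; left; apply/eqP; ring.
Qed.

Lemma enorm_triangle v w : enorm (v + w) <= enorm v + enorm w.
Proof.
rewrite -(@ler_pXn2r _ 2)// ?nnegrE ?addr_ge0 ?enorm_ge0//.
rewrite enorm_sqr sqrrD !enorm_sqr.
have -> : dotv (v + w) (v + w) = dotv v v + dotv v w *+ 2 + dotv w w.
  rewrite /dotv -sumrMnl -!big_split/=; apply: eq_bigr => i _.
  by rewrite !mxE; ring.
by rewrite lerD2r lerD2l lerMn2r dotv_le orbT.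
Qed.

Lemma enorm_le_coord v (C : R) : (forall i, `|v ord0 i| <= C) ->
  enorm v <= Num.sqrt (n%:R * C ^+ 2).
Proof.
move=> vC; rewrite /enorm ler_wsqrtr// /dotv.
apply: (@le_trans _ _ (\sum_(i < n) C ^+ 2)).
  apply: ler_sum => i _; rewrite -expr2 -real_normK ?num_real//.
  by rewrite lerXn2r ?nnegrE// (le_trans _ (vC i)).
by rewrite sumr_const card_ord mulr_natl.
Qed.

End euclidean_norm.

Section domain.
Context {R : realType} {n : nat} {Omega : set 'rV[R]_n}.
Hypothesis mO : measurable Omega.
Implicit Types (u : 'rV[R]_n -> R) (g : 'rV[R]_n -> 'rV[R]_n).

Lemma measurable_enorm g : measurable_fun Omega g ->
  measurable_fun Omega (enorm \o g).
Proof.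
move=> mg; apply: (measurableT_comp (f := enorm)) mg.
apply: (measurableT_comp (f := @Num.sqrt R)).
  by apply: continuous_measurable_fun; exact: sqrt_continuous.
rewrite /dotv; apply: measurable_sum => i.
by apply: measurable_funM; exact: measurable_row_coord.
Qed.

Lemma measurable_powR_norm u a : measurable_fun Omega u ->
  measurable_fun Omega (fun x => powR `|u x| a).
Proof.
move=> mu; apply: (measurableT_comp (measurable_powR a)).
exact: measurableT_comp.
Qed.

Lemma measurable_powR_enorm g a : measurable_fun Omega g ->
  measurable_fun Omega (fun x => powR (enorm (g x)) a).
Proof.
move=> mg; apply: (measurableT_comp (measurable_powR a)).
exact: measurable_enorm.
Qed.

Lemma poweR_inv_lty (x : \bar R) (p : R) : 0 < p -> (poweR x p^-1 < +oo)%E ->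
  (x < +oo)%E.
Proof. by move=> p0; apply: lty_poweRy; rewrite invr_eq0 gt_eqF. Qed.

Section Sobolev_functions.
Variable p : R.
Hypothesis p0 : 0 < p.
Implicit Types w : W01p Omega p.

Lemma W01p_measurable w : measurable_fun Omega w.
Proof. by case: w => ? ? [[]]. Qed.

Lemma W01p_measurable_nabla w : measurable_fun Omega (nabla w).
Proof. by case: w => ? ? [[]]. Qed.

Lemma W01p_integrable w :
  (lebesgue_row n).-integrable Omega (fun x => (powR `|w x| p)%:E).
Proof.
apply/integrableP; split.
  by apply/measurable_EFinP; apply: measurable_powR_norm; exact: W01p_measurable.
case: w => w g [_ + _ _] _ /=; rewrite /Lp_norm => /(poweR_inv_lty p0).
congr (_ < _)%E; apply: eq_integral => x _.
by congr EFin; rewrite [RHS]ger0_norm ?powR_ge0.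
Qed.

Lemma W01p_integrable_nabla w :
  (lebesgue_row n).-integrable Omega (fun x => (powR (enorm (nabla w x)) p)%:E).
Proof.
apply/integrableP; split.
  by apply/measurable_EFinP; apply: measurable_powR_enorm; exact: W01p_measurable_nabla.
case: w => w g [_ _ + _] _ /=; rewrite /Lp_norm => /(poweR_inv_lty p0).
congr (_ < _)%E; apply: eq_integral => x _.
by congr EFin; rewrite [RHS]ger0_norm ?powR_ge0//= ger0_norm ?enorm_ge0.
Qed.

(** A single test function at a given distance takes the place of the approximating
    sequence; without the p-th root the distance can be compared with other integrals
    of p-th powers term by term. *)
Lemma W01p_approx w (d : R) : 0 < d -> exists2 phi, test_function Omega phi &
  (\int[lebesgue_row n]_(x in Omega) (powR `|phi x - w x| p)%:E +
   \int[lebesgue_row n]_(x in Omega)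
     (powR (enorm (gradient phi x - nabla w x)) p)%:E <= d%:E)%E.
Proof.
move=> d0; have [phi [tphi cphi]] := W01p_closure w.
have dp0 : 0 < powR d p^-1 by exact: powR_gt0.
move/fine_cvgP : cphi => [fin /cvgr0Pnorm_lt/(_ _ dp0) small].
have [k [fk sk]] : exists k, sobolev_norm Omega p (phi k \- w)
    (gradient (phi k) \- nabla w) \is a fin_num /\
    `|fine (sobolev_norm Omega p (phi k \- w) (gradient (phi k) \- nabla w))|
      < powR d p^-1.
  have [N _ HN] := filterI fin small.
  by exists N; exact: (HN N (leqnn N)).
exists (phi k); first exact: tphi.
move: fk sk; rewrite /sobolev_norm; set S := (X in poweR X _) => fk sk.
have S0 : (0 <= S)%E.
  by apply: adde_ge0; apply: integral_ge0 => x _; rewrite lee_fin powR_ge0.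
have Sfin : S \is a fin_num.
  rewrite ge0_fin_numE//; apply: (poweR_inv_lty p0).
  by rewrite -ge0_fin_numE// poweR_ge0.
rewrite -[leLHS]/S -(fineK Sfin) lee_fin leNgt; apply/negP => dS.
move: sk; rewrite -(fineK Sfin) poweR_EFin/= ger0_norm ?powR_ge0//.
rewrite ltNge => /negP; apply; apply: ge0_ler_powR (ltW dS).
- by rewrite invr_ge0 ltW.
- by rewrite nnegrE ltW.
- by rewrite nnegrE fine_ge0.
Qed.

End Sobolev_functions.

End domain.

(** * Inequalities for powers *)

Section power_inequalities.
Context {R : realType}.
Implicit Types (a b c d p q s t x y : R).

Lemma powR_mulD x s t : 0 <= x -> 0 <= s -> 0 <= t ->
  powR x s * powR x t = powR x (s + t).
Proof.
move=> x0 s0 t0; have [st|st] := eqVneq (s + t) 0.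
  have s00 : s = 0 by lra.
  have t00 : t = 0 by lra.
  by rewrite s00 t00 addr0 !powRr0 mulr1.
by rewrite powRD// (negbTE st).
Qed.

Lemma powR2 x : 0 <= x -> powR x 2 = x ^+ 2.
Proof. exact: powR_mulrn. Qed.

Lemma powR_homo s x y : 0 <= s -> 0 <= x -> x <= y -> powR x s <= powR y s.
Proof.
by move=> s0 x0 xy; apply: ge0_ler_powR; rewrite // nnegrE// (le_trans x0).
Qed.

Lemma powR_mul_le x y s t : 0 <= x -> 0 <= y -> 0 <= s -> 0 <= t ->
  powR x s * powR y t <= powR x (s + t) + powR y (s + t).
Proof.
move=> x0 y0 s0 t0; have [xy|/ltW yx] := leP x y.
  apply: (@le_trans _ _ (powR y s * powR y t)).
    by apply: ler_wpM2r; rewrite ?powR_ge0 ?powR_homo.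
  by rewrite powR_mulD// lerDr powR_ge0.
apply: (@le_trans _ _ (powR x s * powR x t)).
  by apply: ler_wpM2l; rewrite ?powR_ge0 ?powR_homo.
by rewrite powR_mulD// lerDl powR_ge0.
Qed.

(** Young's inequality with a small first coefficient: compare [y] with [r x] for
    the [r] such that [r^t = e]. *)
Lemma powR_mul_young s t (e : R) : 0 <= s -> 0 < t -> 0 < e ->
  exists2 K, 0 <= K & forall x y, 0 <= x -> 0 <= y ->
    powR x s * powR y t <= e * powR x (s + t) + K * powR y (s + t).
Proof.
move=> s0 t0 e0; pose r := powR e t^-1.
have r0 : 0 < r by exact: powR_gt0.
exists (powR r^-1 s); first exact: powR_ge0.
move=> x y x0 y0; have [yx|/ltW xy] := leP y (r * x).
  apply: (@le_trans _ _ (powR x s * powR (r * x) t)).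
    by apply: ler_wpM2l; rewrite ?powR_ge0// powR_homo// ltW.
  rewrite powRM ?(ltW r0)// /r -powRrM mulVf ?gt_eqF// powRr1 ?(ltW e0)//.
  by rewrite mulrCA powR_mulD ?(ltW t0)// lerDl mulr_ge0// powR_ge0.
apply: (@le_trans _ _ (powR (r^-1 * y) s * powR y t)).
  by apply: ler_wpM2r; rewrite ?powR_ge0// powR_homo// mulrC ler_pdivlMr// mulrC.
rewrite powRM ?invr_ge0 ?(ltW r0)// -mulrA powR_mulD ?(ltW t0)// lerDr.
by rewrite mulr_ge0 ?powR_ge0// ltW.
Qed.

(** Takes the place of a convexity argument: in either case the sum can be replaced by
    a multiple of one of its terms before powers are taken. *)
Lemma add_le_or (k : R) a b : 0 < k -> 0 <= a -> 0 <= b ->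
  a + b <= (1 + k) * a \/ a + b <= (1 + k^-1) * b.
Proof.
move=> k0 a0 b0; have [ba|ab] := leP b (k * a).
  by left; rewrite mulrDl mul1r lerD2l.
right; rewrite mulrDl mul1r addrC lerD2l mulrC ler_pdivlMr// mulrC; exact: ltW.
Qed.

Lemma exists_dilation p (e : R) : 0 < p -> 0 < e ->
  exists2 k, 0 < k & powR (1 + k) p = 1 + e.
Proof.
move=> p0 e0; have e1 : 1 < 1 + e by rewrite ltrDl.
exists (powR (1 + e) p^-1 - 1).
  have : powR 1 p^-1 < powR (1 + e) p^-1.
    apply: gt0_ltr_powR; rewrite ?invr_gt0 ?nnegrE ?ler01//.
    exact: le_trans ler01 (ltW e1).
  by rewrite powR1 subr_gt0.
rewrite addrC subrK -powRrM mulVf ?gt_eqF// powRr1// ltW//.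
by rewrite (lt_trans ltr01).
Qed.

Lemma powR_perturb p (e : R) : 0 < p -> 0 < e ->
  exists2 K, 0 <= K & forall a b, 0 <= a -> 0 <= b ->
    powR (a + b) p <= (1 + e) * powR a p + K * powR b p.
Proof.
move=> p0 e0; have [k k0 kp] := exists_dilation p0 e0.
exists (powR (1 + k^-1) p); first exact: powR_ge0.
move=> a b a0 b0.
have L0 : 0 <= 1 + k^-1 by rewrite addr_ge0// invr_ge0 ltW.
have K0 : 0 <= 1 + k by rewrite addr_ge0// ltW.
have [h|h] := add_le_or k0 a0 b0.
  apply: (le_trans (powR_homo (ltW p0) (addr_ge0 a0 b0) h)).
  by rewrite powRM// kp lerDl mulr_ge0// powR_ge0.
apply: (le_trans (powR_homo (ltW p0) (addr_ge0 a0 b0) h)).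
by rewrite powRM// lerDr mulr_ge0 ?powR_ge0// addr_ge0// ltW.
Qed.

(** Bookkeeping for the four cases of the next lemma. *)
Lemma le_sum_of_alternatives (S X A B C D e k1 k2 k3 : R) :
  0 <= X -> 0 <= A -> 0 <= B -> 0 <= C -> 0 <= D ->
  0 <= e -> 0 <= k1 -> 0 <= k2 -> 0 <= k3 ->
  [\/ S <= X, S <= e * A + k1 * D, S <= e * C + k2 * B | S <= k3 * (B + D)] ->
  S <= X + e * (A + C) + (k1 + k2 + k3) * (B + D).
Proof.
move=> X0 A0 B0 C0 D0 e0 k10 k20 k30.
have h1 := mulr_ge0 e0 A0; have h2 := mulr_ge0 e0 C0.
have h3 := mulr_ge0 k10 B0; have h4 := mulr_ge0 k10 D0.
have h5 := mulr_ge0 k20 B0; have h6 := mulr_ge0 k20 D0.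
have h7 := mulr_ge0 k30 B0; have h8 := mulr_ge0 k30 D0.
case; lra.
Qed.

(** Shows that [u |-> int |u|^(p-2) |grad u|^2] is upper semicontinuous along
    sequences converging in W^{1,p}, although the integrand is not convex for p > 2:
    read [a], [c] for the limit and [b], [d] for the error. Each of the sums [a + b] and
    [c + d] is dominated by one of its terms; if the same kind of term dominates in both,
    the bound is immediate, and the two mixed products are absorbed by Young's
    inequality. *)
Lemma powR_mul2_perturb p (e : R) : 2 <= p -> 0 < e ->
  exists2 K, 0 <= K & forall a b c d, 0 <= a -> 0 <= b -> 0 <= c -> 0 <= d ->
    powR (a + b) (p - 2) * powR (c + d) 2 <=
    (1 + e) * (powR a (p - 2) * powR c 2) + e * (powR a p + powR c p)
    + K * (powR b p + powR d p).
Proof.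
move=> p2 e0; have p0 : 0 < p by rewrite (lt_le_trans _ p2).
have s0 : 0 <= p - 2 by rewrite subr_ge0.
have sp : p - 2 + 2 = p by rewrite subrK.
have [k k0 kp] := exists_dilation p0 e0.
set H := 1 + k in kp; set L := 1 + k^-1.
have L0 : 0 < L by rewrite addr_gt0// invr_gt0.
have H0 : 0 < H by rewrite addr_gt0.
(* [M] bounds the coefficients of both mixed products, so that Young's inequality
   with [e / M] leaves a coefficient of at most [e]. *)
pose M := powR H (p - 2) * powR L 2 + powR L (p - 2) * powR H 2.
have M0 : 0 < M by rewrite addr_gt0// mulr_gt0// powR_gt0.
have eM0 : 0 < e / M by rewrite divr_gt0.
have [K1 K10 y1] := powR_mul_young s0 (ltr0Sn R 1) eM0.
have [K2 K20 y2] : exists2 K2, 0 <= K2 & 2 < p -> forall x y, 0 <= x -> 0 <= y ->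
    powR x 2 * powR y (p - 2) <= e / M * powR x p + K2 * powR y p.
  have [p2'|p2'] := ltP 2 p; last by exists 0.
  have s1 : 0 < p - 2 by rewrite subr_gt0.
  have [K2 K20 y2] := powR_mul_young (ler0n R 2) s1 eM0.
  exists K2 => [//|_ x y x0 y0].
  by have := y2 x y x0 y0; rewrite [2 + _]addrC sp.
have ML1 : powR H (p - 2) * powR L 2 <= M by rewrite lerDl mulr_ge0 ?powR_ge0.
have ML2 : powR L (p - 2) * powR H 2 <= M by rewrite lerDr mulr_ge0 ?powR_ge0.
have M0' := ltW M0.
have EM x y k' : M * (e / M * x + k' * y) = e * x + M * k' * y.
  by field; rewrite gt_eqF.
exists (M * K1 + M * K2 + powR L p).
  by rewrite !addr_ge0 ?powR_ge0// mulr_ge0.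
move=> a b c d a0 b0 c0 d0.
have up x y : powR x (p - 2) * powR y 2 >= 0 by rewrite mulr_ge0 ?powR_ge0.
have red X Y x y : 0 <= X -> 0 <= Y -> 0 <= x -> 0 <= y ->
    a + b <= X * x -> c + d <= Y * y ->
    powR (a + b) (p - 2) * powR (c + d) 2 <=
    (powR X (p - 2) * powR Y 2) * (powR x (p - 2) * powR y 2).
  move=> X0 Y0 x0 y0 abX cdY; rewrite mulrACA -!powRM//.
  apply: ler_pM; rewrite ?powR_ge0//.
    by apply: powR_homo => //; exact: addr_ge0.
  by apply: powR_homo => //; exact: addr_ge0.
have X0 : 0 <= (1 + e) * (powR a (p - 2) * powR c 2).
  by apply: mulr_ge0 (up _ _); rewrite addr_ge0// ltW.
apply: (le_sum_of_alternatives X0 (powR_ge0 _ _) (powR_ge0 _ _) (powR_ge0 _ _)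
  (powR_ge0 _ _) (ltW e0) (mulr_ge0 M0' K10) (mulr_ge0 M0' K20) (powR_ge0 _ _)).
have [h|h] := add_le_or k0 a0 b0; have [h'|h'] := add_le_or k0 c0 d0.
- apply: Or41; apply: (le_trans (red _ _ _ _ (ltW H0) (ltW H0) a0 c0 h h')).
  by rewrite powR_mulD ?sp ?kp ?(ltW H0).
- apply: Or42; apply: (le_trans (red _ _ _ _ (ltW H0) (ltW L0) a0 d0 h h')).
  apply: (le_trans (ler_wpM2r (up _ _) ML1)).
  by have := ler_wpM2l M0' (y1 a d a0 d0); rewrite sp EM.
- have [p2'|p2'] := ltP 2 p.
    apply: Or43; apply: (le_trans (red _ _ _ _ (ltW L0) (ltW H0) b0 c0 h h')).
    apply: (le_trans (ler_wpM2r (up _ _) ML2)).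
    by have := ler_wpM2l M0' (y2 p2' c b c0 b0); rewrite EM (mulrC (powR c 2)).
  (* For p = 2 the factor (a + b)^(p-2) is 1 and Young's inequality is not
     available, but then a + b may be replaced by the dilation of a. *)
  apply: Or41.
  have pE : p = 2 by apply/le_anti; rewrite p2 p2'.
  have HE : powR H 2 = 1 + e by rewrite -pE kp.
  rewrite pE subrr !powRr0 !mul1r -HE -powRM ?(ltW H0)//.
  by apply: powR_homo; rewrite ?addr_ge0.
- apply: Or44; apply: (le_trans (red _ _ _ _ (ltW L0) (ltW L0) b0 d0 h h')).
  rewrite powR_mulD ?sp ?(ltW L0)//; apply: ler_wpM2l; first exact: powR_ge0.
  by have := powR_mul_le b0 d0 s0 (ler0n R 2); rewrite sp.
Qed.

End power_inequalities.

(** * Test functions as elements of W_0^{1,p} *)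

Section bounded_open_set.
Context {R : realType} {n : nat} {Omega : set 'rV[R]_n}.
Hypotheses (oO : open Omega) (bO : bounded_set Omega).
Implicit Types (u f phi psi : 'rV[R]_n -> R) (g : 'rV[R]_n -> 'rV[R]_n).

Lemma measurable_domain : measurable Omega.
Proof. exact: open_measurable_row. Qed.
Let mO := measurable_domain.

Lemma domain_box : exists2 M, 0 < M & Omega `<=` box 0 M.
Proof.
have [M [Mr HM]] := bO.
exists (`|M| + 2) => [|x Ox i]; first by rewrite ltr_wpDl.
have M1 : M < `|M| + 1 by rewrite (le_lt_trans (ler_norm M))// ltrDl.
have := HM _ M1 x Ox; rewrite /= mxE subr0 => h.
apply: (@le_lt_trans _ _ `|x|); last by rewrite (le_lt_trans h)// ltrD2l ltr1n.
rewrite [leRHS]/Num.Def.normr/= mx_normrE.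
by apply/bigmax_geP; right => /=; exists (ord0, i).
Qed.

Lemma domain_finite : (lebesgue_row n Omega < +oo)%E.
Proof.
have [M M0 OM] := domain_box.
apply: le_lt_trans (lebesgue_row_box_lty n M).
by apply: le_measure; rewrite // inE//; exact: measurable_box.
Qed.

Lemma bounded_integrable f C : measurable_fun Omega f ->
  (forall x, Omega x -> `|f x| <= C) ->
  (lebesgue_row n).-integrable Omega (EFin \o f).
Proof.
move=> mf fC; apply: (@measurable_bounded_integrable _ _ _ (lebesgue_row n)) => //.
  exact: domain_finite.
exists C; split; [exact: num_real|] => D CD x Ox /=.
by rewrite (le_trans (fC x Ox))// ltW.
Qed.

Lemma continuous_measurable_domain f : continuous f -> measurable_fun Omega f.
Proof.
by move=> cf; apply: measurable_funS (continuous_measurable_row cf).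
Qed.

Lemma test_measurable phi : test_function Omega phi -> measurable_fun Omega phi.
Proof.
by move=> t; apply: continuous_measurable_domain; exact: smooth_continuous t.1.
Qed.

Lemma gradient_measurable phi : smooth phi -> measurable_fun Omega (gradient phi).
Proof.
move=> sphi; apply: (@measurable_funS _ _ _ _ setT) => //.
apply: measurable_fun_rowP => i; under eq_fun do rewrite mxE.
by apply: continuous_measurable_row; exact/smooth_continuous/smooth_partial.
Qed.

Lemma gradient_bounded phi : test_function Omega phi ->
  exists2 C, 0 < C & forall x, enorm (gradient phi x) <= C.
Proof.
move=> tphi.
have /choice[C HC] : forall i : 'I_n, exists C, forall x, `|partial i phi x| <= C.
  by move=> i; have [C _ HC] := test_bounded (test_partial i tphi); exists C.
exists (Num.sqrt (n%:R * (\sum_i `|C i|) ^+ 2) + 1).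
  by rewrite ltr_wpDl// sqrtr_ge0.
move=> x; apply: (@le_trans _ _ (Num.sqrt (n%:R * (\sum_i `|C i|) ^+ 2))).
  apply: enorm_le_coord => i; rewrite mxE (le_trans (HC i x))//.
  rewrite (le_trans (ler_norm _))// (bigD1 i)//= lerDl.
  exact: sumr_ge0.
by rewrite lerDl.
Qed.

Lemma test_integral_partial phi i : test_function Omega phi ->
  (\int[lebesgue_row n]_(x in Omega) (partial i phi x)%:E = 0)%E.
Proof.
move=> tphi; have [M M0 OM] := domain_box.
have sphi := test_smooth tphi.
have z x : ~ Omega x -> phi x = 0 /\ partial i phi x = 0.
  by move=> Ox; split; [exact: test_out tphi Ox|
    exact: test_out (test_partial i tphi) Ox].
rewrite integral_mkcond.
transitivity (\int[lebesgue_row n]_x (partial i phi x)%:E)%E.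
  apply: eq_integral => x _; rewrite patchE; case: ifPn => //.
  by rewrite notin_setE => /z[_ ->].
apply: (int_partial_eq0 (i := i) (f := phi) M0).
- exact: smooth_continuous.
- exact/smooth_continuous/smooth_partial.
- by move=> x; exact: smooth_is_derive.
- by move=> x bx; apply: z => /OM.
Qed.

(** Integration by parts is the vanishing of the integral of
    [partial i (phi psi)]. *)
Lemma test_weak_gradient phi : test_function Omega phi ->
  weak_gradient Omega phi (gradient phi).
Proof.
move=> tphi psi i tpsi.
have sphi := test_smooth tphi; have spsi := test_smooth tpsi.
have prod_int f h : test_function Omega f -> test_function Omega h ->
    (lebesgue_row n).-integrable Omega (fun x => (f x * h x)%:E).
  move=> tf th; have tfh := test_mulr tf (test_smooth th).
  have [C _ HC] := test_bounded tfh.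
  by apply: (@bounded_integrable _ C) => //; exact: test_measurable.
have i1 := prod_int _ _ tphi (test_partial i tpsi).
have i2 := prod_int _ _ (test_partial i tphi) tpsi.
have E : (\int[lebesgue_row n]_(x in Omega) (phi x * partial i psi x)%:E +
    \int[lebesgue_row n]_(x in Omega) (partial i phi x * psi x)%:E = 0)%E.
  rewrite -integralD// -(test_integral_partial i (test_mulr tphi spsi)).
  apply: eq_integral => x _; rewrite -EFinD partialM//.
  by rewrite [partial i phi x * _]mulrC.
under [in RHS]eq_integral do rewrite mxE.
have f2 := integrable_fin_num mO i2.
by rewrite -[LHS]adde0 -(subee f2) addeA E add0e.
Qed.

Lemma W01p_of_test p phi : 0 < p -> test_function Omega phi ->
  exists w : W01p Omega p, W01p_fun w = phi /\ nabla w = gradient phi.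
Proof.
move=> p0 tphi; have sphi := test_smooth tphi.
have [C C0 HC] := test_bounded tphi; have [D D0 HD] := gradient_bounded tphi.
have lt f K : measurable_fun Omega f -> (forall x, `|f x| <= K) -> 0 < K ->
    (Lp_norm Omega p f < +oo)%E.
  move=> mf fK K0; apply/poweR_lty/integrable_lty => //.
  apply: (@bounded_integrable _ (powR K p)); first exact: measurable_powR_norm.
  move=> x _; rewrite ger0_norm ?powR_ge0//.
  by apply: powR_homo => //; exact: ltW.
have W : W1p Omega p phi (gradient phi).
  split.
  - by split; [exact: test_measurable|exact: gradient_measurable].
  - by apply: lt HC _ => //; exact: test_measurable.
  - apply: (@lt _ D) => //.
      by apply: measurable_enorm; exact: gradient_measurable.
    by move=> x; rewrite ger0_norm ?enorm_ge0//; exact: HD.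
  - exact: test_weak_gradient.
have cl : exists phi_ : nat -> 'rV[R]_n -> R,
    (forall k, test_function Omega (phi_ k)) /\
    (fun k => sobolev_norm Omega p (phi_ k \- phi)
                                   (gradient (phi_ k) \- gradient phi)) @ \oo --> 0%E.
  exists (fun=> phi); split=> //.
  rewrite (_ : (fun k => _) = cst 0%E); first exact: cvg_cst.
  apply/funext => k; rewrite /sobolev_norm.
  rewrite !integral0_eq ?adde0 ?poweR0r// ?invr_eq0 ?gt_eqF// => x _.
    by rewrite /= subrr enorm0 powR0// gt_eqF.
  by rewrite /= subrr normr0 powR0// gt_eqF.
by exists (Build_W01p W cl).
Qed.

End bounded_open_set.

(** * Scaling in W_0^{1,p} *)

Section bounded_open_set.
Context {R : realType} {n : nat} {Omega : set 'rV[R]_n}.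
Hypotheses (oO : open Omega) (bO : bounded_set Omega).
Implicit Types (u f h phi psi : 'rV[R]_n -> R) (g : 'rV[R]_n -> 'rV[R]_n).

Let mO := measurable_domain oO.

(** With [h = |u|^p], the finite measure of the domain makes the product of an L^p
    function and a bounded one integrable, so that the weak gradient identity may be
    multiplied by a constant. *)
Lemma integrable_le_affine f h C : measurable_fun Omega f -> 0 <= C ->
  (lebesgue_row n).-integrable Omega (EFin \o h) ->
  (forall x, Omega x -> `|f x| <= C * (1 + h x)) ->
  (lebesgue_row n).-integrable Omega (EFin \o f).
Proof.
move=> mf C0 ih fh.
have i1 : (lebesgue_row n).-integrable Omega (EFin \o (fun=> 1 : R)).
  by apply: (bounded_integrable oO bO (C := 1)) => // x _; rewrite normr1.
have := integrableZl mO C (integrableD mO i1 ih).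
apply: le_integrable => //; first exact/measurable_EFinP.
move=> x Ox; rewrite /= lee_fin (le_trans (fh x Ox))//.
exact: ler_norm.
Qed.

Lemma measurable_fun_row_on g :
  (forall i, measurable_fun Omega (fun x => g x ord0 i)) ->
  measurable_fun Omega g.
Proof.
move=> mg.
apply: (@measurability _ _ _ _ Omega g (\big[setU/set0]_(i < n)
  preimage_set_system setT (fun x : 'rV[R]_n => x ord0 i) measurable)) => //.
move=> _ [B + <-]; rewrite -bigcup_seq/= => -[i _ [C mC <-]].
by rewrite setTI; exact: mg.
Qed.

Section scaling.
Variables (p : R) (c : R).
Hypotheses (p1 : 1 <= p) (c0 : 0 < c).
Implicit Type w : W01p Omega p.

Let p0 : 0 < p. Proof. exact: lt_le_trans p1. Qed.

Lemma powR_normZ (a : R) : powR `|c * a| p = powR c p * powR `|a| p.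
Proof. by rewrite normrM powRM// ger0_norm// ltW. Qed.

Lemma powR_enormZ (v : 'rV[R]_n) :
  powR (enorm (c *: v)) p = powR c p * powR (enorm v) p.
Proof. by rewrite enormZ powRM ?enorm_ge0// ger0_norm// ltW. Qed.

Lemma le_1D_powR (a : R) : 0 <= a -> a <= 1 + powR a p.
Proof.
move=> a0; have [a1|a1] := leP a 1; first by rewrite (le_trans a1)// lerDl powR_ge0.
by apply: (@le_trans _ _ (powR a p)); [exact: le1r_powR (ltW a1) p1|rewrite lerDr].
Qed.

Lemma measurable_rowZ g : measurable_fun Omega g ->
  measurable_fun Omega (fun x => c *: g x).
Proof.
move=> mg; apply: (measurableT_comp (f := (fun v => c *: v) : 'rV[R]_n -> 'rV[R]_n)) mg.
apply: measurable_fun_rowP => i; under eq_fun do rewrite mxE.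
by apply: measurable_funM => //; exact: measurable_row_coord.
Qed.

Lemma measurable_rowB g (h' : 'rV[R]_n -> 'rV[R]_n) :
  measurable_fun Omega g -> measurable_fun Omega h' ->
  measurable_fun Omega (fun x => g x - h' x : 'rV[R]_n).
Proof.
move=> mg mh; apply: measurable_fun_row_on => i; under eq_fun do rewrite !mxE.
by apply: measurable_funB; exact: measurableT_comp (measurable_row_coord i) _.
Qed.

Lemma ge0_integral_powRZ f : measurable_fun Omega f -> (forall x, 0 <= f x) ->
  (\int[lebesgue_row n]_(x in Omega) (powR c p * f x)%:E =
   (powR c p)%:E * \int[lebesgue_row n]_(x in Omega) (f x)%:E)%E.
Proof.
move=> mf f0; rewrite -ge0_integralZl_EFin ?powR_ge0//.
- by move=> x _; rewrite lee_fin.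
- exact/measurable_EFinP.
Qed.

Lemma sobolev_normZ u g : measurable_fun Omega u -> measurable_fun Omega g ->
  sobolev_norm Omega p (fun x => c * u x) (fun x => c *: g x) =
  (c%:E * sobolev_norm Omega p u g)%E.
Proof.
move=> mu mg; rewrite /sobolev_norm.
under eq_integral do rewrite powR_normZ.
under [X in (_ + X)%E]eq_integral do rewrite powR_enormZ.
rewrite (ge0_integral_powRZ (measurable_powR_norm _ mu)) => [|x]; last exact: powR_ge0.
rewrite (ge0_integral_powRZ (measurable_powR_enorm _ mg)) => [|x]; last exact: powR_ge0.
rewrite -ge0_muleDr; [|by apply: integral_ge0 => x _; rewrite lee_fin powR_ge0..].
rewrite poweRM ?lee_fin ?powR_ge0//; last first.
  by apply: adde_ge0; apply: integral_ge0 => x _; rewrite lee_fin powR_ge0.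
by rewrite poweR_EFin -powRrM mulfV ?gt_eqF// powRr1// ltW.
Qed.

Lemma W01pZ w : exists w' : W01p Omega p,
  (W01p_fun w' = fun x => c * w x) /\ (nabla w' = fun x => c *: nabla w x).
Proof.
have mw := W01p_measurable w; have mg := W01p_measurable_nabla w.
have iw := W01p_integrable p0 w; have ig := W01p_integrable_nabla p0 w.
have W : W1p Omega p (fun x => c * w x) (fun x => c *: nabla w x).
  split.
  - by split; [exact: measurable_funM|exact: measurable_rowZ].
  - apply: poweR_lty; under eq_integral do rewrite powR_normZ.
    rewrite (ge0_integral_powRZ (measurable_powR_norm _ mw)) => [|x];
      last exact: powR_ge0.
    by rewrite lte_mul_pinfty ?lee_fin ?powR_ge0//; exact: integrable_lty iw.
  - apply: poweR_lty.
    under eq_integral do rewrite /= ger0_norm ?enorm_ge0// powR_enormZ.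
    rewrite (ge0_integral_powRZ (measurable_powR_enorm _ mg)) => [|x];
      last exact: powR_ge0.
    by rewrite lte_mul_pinfty ?lee_fin ?powR_ge0//; exact: integrable_lty ig.
  - move=> phi i tphi.
    have [C C0 HC] := test_bounded (test_partial i tphi).
    have [D D0 HD] := test_bounded tphi.
    have i1 : (lebesgue_row n).-integrable Omega
        (fun x => (w x * partial i phi x)%:E).
      apply: (integrable_le_affine (h := fun x => powR `|w x| p) _ (ltW C0)) => //.
        by apply: measurable_funM => //; exact: test_measurable (test_partial i tphi).
      move=> x _; rewrite normrM mulrC; apply: ler_pM => //.
      exact: le_1D_powR.
    have i2 : (lebesgue_row n).-integrable Omega
        (fun x => (nabla w x ord0 i * phi x)%:E).
      apply: (integrable_le_affine
        (h := fun x => powR (enorm (nabla w x)) p) _ (ltW D0)) => //.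
        apply: measurable_funM => //; last exact: test_measurable.
        exact: measurableT_comp (measurable_row_coord i) mg.
      move=> x _; rewrite normrM mulrC; apply: ler_pM => //.
      by apply: le_trans (coord_le_enorm _ _) (le_1D_powR _); exact: enorm_ge0.
    under eq_integral do rewrite -mulrA EFinM.
    rewrite integralZl//.
    have [_ _ _ wg] := W01p_W1p w; rewrite wg// muleN; congr (- _)%E.
    rewrite -integralZl//; apply: eq_integral => x _.
    by rewrite mxE -mulrA EFinM.
have [phi [tphi cphi]] := W01p_closure w.
have cl : exists phi_ : nat -> 'rV[R]_n -> R,
    (forall k, test_function Omega (phi_ k)) /\
    (fun k => sobolev_norm Omega p (phi_ k \- (fun x => c * w x))
      (gradient (phi_ k) \- (fun x => c *: nabla w x))) @ \oo --> 0%E.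
  exists (fun k x => phi k x * c); split.
    by move=> k; apply: test_mulr; [exact: tphi|exact: smooth_cst].
  rewrite (_ : (fun k => _) = (fun k => c%:E * sobolev_norm Omega p (phi k \- w)%R
                 (gradient (phi k) \- nabla w)%R)%E).
    rewrite -[X in _ --> X](mule0 c%:E); apply: cvgeZl => //.
  apply/funext => k; have sk := test_smooth (tphi k).
  rewrite -sobolev_normZ.
  - have -> : (fun x => phi k x * c) \- (fun x => c * w x) =
        (fun x => c * (phi k x - w x)).
      by apply/funext => x; rewrite mulrBr (mulrC c (phi k x)).
    have gc : gradient (fun x => phi k x * c) = fun x => c *: gradient (phi k) x.
      apply/funext => x; apply/rowP => i; rewrite !mxE -partialZ//.
      by congr (partial i _ x); apply/funext => y; rewrite mulrC.
    rewrite gc; congr (sobolev_norm _ _ _ _).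
    by apply/funext => x; rewrite scalerBr.
  - by apply: measurable_funB => //; exact: test_measurable (tphi k).
  - by apply: measurable_rowB => //; exact: gradient_measurable.
by exists (Build_W01p W cl).
Qed.

End scaling.

End bounded_open_set.

(** * Energy inequalities and density *)

(** For removing the small parameter at the end of the density argument. *)
Lemma le_of_small (R : realType) (x y z : R) :
  (forall e, 0 < e -> e <= 1 -> x <= y + e * z) -> x <= y.
Proof.
move=> H; rewrite leNgt; apply/negP => yx.
have z0 : 0 <= `|z| by [].
have d0 : 0 < x - y by rewrite subr_gt0.
pose e := Num.min 1 ((x - y) / 2 / (`|z| + 1)).
have e0 : 0 < e by rewrite lt_min ltr01/= !divr_gt0// ltr_wpDl.
have := H e e0; rewrite ge_min lexx/= => /(_ isT) Hx.
have ez : e * z <= (x - y) / 2.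
  apply: (@le_trans _ _ (e * (`|z| + 1))).
    by rewrite ler_wpM2l ?(ltW e0)// (le_trans (ler_norm z))// lerDl.
  by rewrite -ler_pdivlMr ?ltr_wpDl// ge_min lexx orbT.
lra.
Qed.

Section Rintegral_comparison.
Context d (T : measurableType d) (R : realType).
Variables (mu : {measure set T -> \bar R}) (D : set T).
Hypothesis mD : measurable D.
Implicit Types f : T -> R.

Local Notation L1 f := (mu.-integrable D (fun x => (f x)%:E)).
Local Notation I f := (\int[mu]_(x in D) f x).

Lemma Rintegral_le_comb2 (a b : R) f f1 f2 : L1 f -> L1 f1 -> L1 f2 ->
  (forall x, D x -> f x <= a * f1 x + b * f2 x) -> I f <= a * I f1 + b * I f2.
Proof.
move=> i0 i1 i2 ff.
have j1 : L1 (fun x => a * f1 x) by exact: (integrableZl mD a i1).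
have j2 : L1 (fun x => b * f2 x) by exact: (integrableZl mD b i2).
rewrite -RintegralZl// -[b * _]RintegralZl// -RintegralD//.
by apply: le_Rintegral => //; exact: (integrableD mD j1 j2).
Qed.

Lemma Rintegral_le_comb3 (a b c : R) f f1 f2 f3 f4 f5 :
  L1 f -> L1 f1 -> L1 f2 -> L1 f3 -> L1 f4 -> L1 f5 ->
  (forall x, D x -> f x <= a * f1 x + b * (f2 x + f3 x) + c * (f4 x + f5 x)) ->
  I f <= a * I f1 + b * (I f2 + I f3) + c * (I f4 + I f5).
Proof.
move=> i0 i1 i2 i3 i4 i5 ff.
have j23 : L1 (fun x => f2 x + f3 x) by exact: (integrableD mD i2 i3).
have j45 : L1 (fun x => f4 x + f5 x) by exact: (integrableD mD i4 i5).
have j : L1 (fun x => b * (f2 x + f3 x) + c * (f4 x + f5 x)).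
  exact: (integrableD mD (integrableZl mD b j23) (integrableZl mD c j45)).
rewrite -addrA -RintegralD// -[I f4 + _]RintegralD//.
apply: (@le_trans _ _ (a * I f1 +
    1 * I (fun x => b * (f2 x + f3 x) + c * (f4 x + f5 x)))).
  by apply: Rintegral_le_comb2 => // x Dx; rewrite mul1r addrA ff.
rewrite mul1r lerD2l; apply: Rintegral_le_comb2 => //.
Qed.

End Rintegral_comparison.

(** The arithmetic of the density argument. [Pw], [Pv], [Pd] are the integrals of
    the p-th powers of the limit, of the test function and of their difference; [S] is
    the p-th power of their Sobolev distance. *)
Lemma perturb_arith (R : realType) (A B e K L S Pw Pv Pd Ev Ew Q : R) :
  0 <= A -> 0 <= B -> 0 < e -> e <= 1 -> 0 <= K -> 0 <= L -> 0 <= Ew -> 0 <= Q ->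
  0 <= Pd -> Pd <= S -> (K + L + 1) * S <= e ->
  Pw <= (1 + e) * Pv + K * Pd -> Ev <= (1 + e) * Ew + e * Q + L * S ->
  A * Pv <= B * Ev ->
  A * Pw <= B * Ew + e * (3 * (B * Ew) + 2 * (B * (Q + 1)) + A).
Proof.
move=> A0 B0 e0 e1 K0 L0 Ew0 Q0 Pd0 PS KS HP HE AB.
have S0 : 0 <= S by exact: le_trans PS.
have e1' : 0 <= 1 + e by rewrite addr_ge0// ltW.
have KPe : K * Pd <= e.
  by have := ler_wpM2l K0 PS; have := mulr_ge0 L0 S0; lra.
have LSe : L * S <= e by have := mulr_ge0 K0 S0; lra.
apply: (@le_trans _ _ ((1 + e) * (A * Pv) + A * e)).
  by have := ler_wpM2l A0 HP; have := ler_wpM2l A0 KPe; lra.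
apply: (@le_trans _ _ ((1 + e) * (B * ((1 + e) * Ew + e * Q + e)) + A * e)).
  rewrite lerD2r; apply: ler_wpM2l => //; apply: (le_trans AB).
  by apply: ler_wpM2l => //; apply: (le_trans HE); rewrite lerD2l.
have BE0 := mulr_ge0 B0 Ew0; have BQ0 := mulr_ge0 B0 Q0.
have ee : e * e <= e by rewrite ger_pMr.
have h1 := ler_wpM2r BE0 ee; have h2 := ler_wpM2r BQ0 ee; have h3 := ler_wpM2r B0 ee.
have h4 := mulr_ge0 (ltW e0) BE0; have h5 := mulr_ge0 (ltW e0) BQ0.
have h6 := mulr_ge0 (ltW e0) B0.
lra.
Qed.

Section energies.
Context {R : realType} {n : nat} (Omega : set 'rV[R]_n).
Implicit Types (u : 'rV[R]_n -> R) (g : 'rV[R]_n -> 'rV[R]_n).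

Definition power_integral (q : R) u : R :=
  \int[lebesgue_row n]_(x in Omega) powR `|u x| q.

Definition gradient_integral (q : R) g : R :=
  \int[lebesgue_row n]_(x in Omega) powR (enorm (g x)) q.

Definition porous_energy (q : R) u g : R :=
  \int[lebesgue_row n]_(x in Omega) (powR `|u x| (q - 2) * powR (enorm (g x)) 2).

(** The assertion that [A / B] is a lower bound of the quotients of test functions;
    stated without division, so that test functions that vanish need no exception. *)
Definition energy_bound (q A B : R) : Prop := forall phi, test_function Omega phi ->
  A * power_integral q phi <= B * porous_energy q phi (gradient phi).

End energies.

Section bounded_open_set.
Context {R : realType} {n : nat} {Omega : set 'rV[R]_n}.
Hypotheses (oO : open Omega) (bO : bounded_set Omega).
Implicit Types (u f h phi psi : 'rV[R]_n -> R) (g : 'rV[R]_n -> 'rV[R]_n).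

Let mO := measurable_domain oO.
Local Notation mu := (lebesgue_row n).
Local Notation P := (power_integral Omega).
Local Notation N := (gradient_integral Omega).
Local Notation E := (porous_energy Omega).

Section exponent.
Variable p : R.
Hypothesis p2 : 2 <= p.
Implicit Type w : W01p Omega p.

Let p0 : 0 < p. Proof. exact: lt_le_trans p2. Qed.
Let p20 : 0 <= p - 2. Proof. by rewrite subr_ge0. Qed.
Let pE : p - 2 + 2 = p. Proof. exact: subrK. Qed.

Lemma power_integral_ge0 u : 0 <= P p u.
Proof. by apply: Rintegral_ge0 => x _; exact: powR_ge0. Qed.

Lemma gradient_integral_ge0 g : 0 <= N p g.
Proof. by apply: Rintegral_ge0 => x _; exact: powR_ge0. Qed.

Lemma porous_energy_ge0 u g : 0 <= E p u g.
Proof. by apply: Rintegral_ge0 => x _; rewrite mulr_ge0 ?powR_ge0. Qed.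

Lemma porous_integrand_measurable u g : measurable_fun Omega u ->
  measurable_fun Omega g ->
  measurable_fun Omega (fun x => powR `|u x| (p - 2) * powR (enorm (g x)) 2).
Proof.
move=> mu mg; apply: measurable_funM; first exact: measurable_powR_norm.
exact: measurable_powR_enorm.
Qed.

Lemma porous_integrable w :
  mu.-integrable Omega
    (fun x => (powR `|w x| (p - 2) * powR (enorm (nabla w x)) 2)%:E).
Proof.
have i1 := W01p_integrable p0 w; have i2 := W01p_integrable_nabla p0 w.
have := integrableD mO i1 i2; apply: le_integrable => //.
  apply/measurable_EFinP; apply: porous_integrand_measurable.
    exact: W01p_measurable.
  exact: W01p_measurable_nabla.
move=> x _; rewrite /= lee_fin [leLHS]ger0_norm ?mulr_ge0 ?powR_ge0//.
rewrite [leRHS]ger0_norm ?addr_ge0 ?powR_ge0//.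
by have := powR_mul_le (normr_ge0 (w x)) (enorm_ge0 (nabla w x)) p20 (ler0n R 2);
  rewrite pE.
Qed.

Lemma W01p_near_test w (d : R) : 0 < d -> exists2 v : W01p Omega p,
  test_function Omega v /\ nabla v = gradient v &
  [/\ mu.-integrable Omega (fun x => (powR `|v x - w x| p)%:E),
      mu.-integrable Omega (fun x => (powR (enorm (nabla v x - nabla w x)) p)%:E) &
      P p (fun x => v x - w x) + N p (fun x => nabla v x - nabla w x) <= d].
Proof.
move=> d0; have [phi tphi small] := W01p_approx p0 w d0.
have [v [vE gE]] := W01p_of_test oO bO p0 tphi.
exists v; first by rewrite gE vE.
have mw := W01p_measurable w; have mgw := W01p_measurable_nabla w.
have mv := W01p_measurable v; have mgv := W01p_measurable_nabla v.
rewrite -gE -vE in small.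
have a0 : (0 <= \int[mu]_(x in Omega) (powR `|v x - w x| p)%:E)%E.
  by apply: integral_ge0 => x _; rewrite lee_fin powR_ge0.
have b0 : (0 <= \int[mu]_(x in Omega) (powR (enorm (nabla v x - nabla w x)) p)%:E)%E.
  by apply: integral_ge0 => x _; rewrite lee_fin powR_ge0.
have i1 : mu.-integrable Omega (fun x => (powR `|v x - w x| p)%:E).
  apply/integrableP; split.
    by apply/measurable_EFinP; apply: measurable_powR_norm; exact: measurable_funB.
  under eq_integral do rewrite gee0_abs ?lee_fin ?powR_ge0//.
  exact: le_lt_trans (le_trans (leeDl _ b0) small) (ltry d).
have i2 : mu.-integrable Omega (fun x => (powR (enorm (nabla v x - nabla w x)) p)%:E).
  apply/integrableP; split.
    by apply/measurable_EFinP; apply: measurable_powR_enorm; exact: measurable_rowB.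
  under eq_integral do rewrite gee0_abs ?lee_fin ?powR_ge0//.
  exact: le_lt_trans (le_trans (leeDr _ a0) small) (ltry d).
split=> //; rewrite -lee_fin EFinD /power_integral /gradient_integral /Rintegral.
by rewrite (fineK (integrable_fin_num mO i1)) (fineK (integrable_fin_num mO i2)).
Qed.

(** By density. If [v] is a test function close to [w], then up to a factor close
    to 1 and a small error, the power integral of [w] is at most that of [v], and the
    energy of [v] is at most that of [w]. *)
Lemma energy_bound_W01p (A B : R) w : 0 <= A -> 0 <= B -> energy_bound Omega p A B ->
  A * P p w <= B * E p w (nabla w).
Proof.
move=> A0 B0 AB.
have iw := W01p_integrable p0 w; have igw := W01p_integrable_nabla p0 w.
have iew := porous_integrable w.
pose Q := P p w + N p (nabla w).
apply: (@le_of_small _ _ _ (3 * (B * E p w (nabla w)) + 2 * (B * (Q + 1)) + A)).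
move=> e e0 e1.
have [K K0 HK] := powR_perturb p0 e0; have [L L0 HL] := powR_mul2_perturb p2 e0.
(* The distance of [v] to [w] is chosen so that the errors with the large
   factors [K] and [L] are at most [e]. *)
have KL0 : 0 < K + L + 1 by rewrite ltr_wpDl// addr_ge0.
have [v [tv gv] [i1 i2 small]] := W01p_near_test w (divr_gt0 e0 KL0).
set S := _ + _ in small.
have iv := W01p_integrable p0 v; have iev := porous_integrable v.
have Pv : P p w <= (1 + e) * P p v + K * P p (fun x => v x - w x).
  apply: Rintegral_le_comb2 => // x _.
  apply: le_trans (HK _ _ (normr_ge0 (v x)) (normr_ge0 (v x - w x))).
  apply: powR_homo => //; first exact: ltW.
  by rewrite [`|v x - w x|]distrC -{1}(subrK (v x) (w x)) addrC ler_normD.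
have Ev : E p v (nabla v) <= (1 + e) * E p w (nabla w) + e * Q + L * S.
  apply: (Rintegral_le_comb3 mO iev iew iw igw i1 i2) => x _.
  apply: le_trans (HL _ _ _ _ (normr_ge0 (w x)) (normr_ge0 (v x - w x))
    (enorm_ge0 (nabla w x)) (enorm_ge0 (nabla v x - nabla w x))).
  apply: ler_pM; rewrite ?powR_ge0//.
    by apply: powR_homo => //; rewrite -{1}(subrK (w x) (v x)) addrC ler_normD.
  apply: powR_homo; rewrite ?enorm_ge0//.
  by rewrite -{1}(subrK (nabla w x) (nabla v x)) addrC enorm_triangle.
have := AB v tv; rewrite -gv => ABv.
have PS : P p (fun x => v x - w x) <= S by rewrite lerDl gradient_integral_ge0.
have Q0 : 0 <= Q by rewrite addr_ge0 ?power_integral_ge0 ?gradient_integral_ge0.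
have KS : (K + L + 1) * S <= e by rewrite mulrC -ler_pdivlMr.
apply: perturb_arith Pv Ev ABv => //; first exact: porous_energy_ge0.
exact: power_integral_ge0.
Qed.

End exponent.

End bounded_open_set.

(** * Regularised powers *)

Section regularised_powers.
Context {R : realType}.
Variables (q r : R).
Hypotheses (q2 : 2 <= q) (r2 : 2 <= r).
Implicit Types (s e : R) (k : nat).

Let q0 : 0 < q. Proof. exact: lt_le_trans q2. Qed.
Let r0 : 0 < r. Proof. exact: lt_le_trans r2. Qed.

(** The exponent [g] for which [s |-> s (s^2 + e)^g] tends to
    [s |-> |s|^(r/q - 1) s] as [e] tends to 0; the q-th power of the latter is [|s|^r]. *)
Definition reg_exponent : R := (r - q) / (2 * q).
Local Notation gam := reg_exponent.

Definition reg s e : R := s * s + e.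

(** [|h|^q] for the regularised power [h s = s (s^2 + e)^g]. *)
Definition reg_mass e s : R := powR `|s| q * powR (reg s e) (gam * q).

(** The derivative of the regularised power at [s], divided by [(s^2 + e)^g]. *)
Definition reg_slope e s : R := (r / q * (s * s) + e) / reg s e.

(** [|h|^(q-2) h'^2] for the regularised power [h]. *)
Definition reg_weight e s : R :=
  powR `|s| (q - 2) * powR (reg s e) (gam * q) * reg_slope e s ^+ 2.

(** At [s = 0] the limit of [reg_weight] depends on the exponents: the factor
    [|s|^(q-2)] is identically 1 for [q = 2], and then [(s^2 + e)^((r-q)/2)] at [s = 0]
    tends to 0 unless [r = 2]. *)
Definition reg_weight_lim s : R :=
  if s == 0 then ((q == 2) && (r == 2))%:R else (r / q) ^+ 2 * powR `|s| (r - 2).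

Lemma gamq : gam * q = (r - q) / 2.
Proof. by rewrite /reg_exponent; field; rewrite gt_eqF. Qed.

Lemma reg_gt0 s e : 0 < e -> 0 < reg s e.
Proof. by move=> e0; rewrite /reg ltr_wpDl// -expr2 sqr_ge0. Qed.

Lemma norm_le_reg s e a : 0 < e -> 0 <= a -> powR `|s| a <= powR (reg s e) (a / 2).
Proof.
move=> e0 a0; rewrite {1}(_ : a = 2 * (a / 2)); last by field.
rewrite powRrM; apply: powR_homo; rewrite ?powR_ge0 ?divr_ge0//.
by rewrite powR2// real_normK ?num_real// /reg expr2 lerDl ltW.
Qed.

Lemma reg_le s e (M : R) : 0 < e -> e <= 1 -> `|s| <= M -> reg s e <= M ^+ 2 + 1.
Proof.
move=> e0 e1 sM; apply: lerD => //.
by rewrite -expr2 -real_normK ?num_real// lerXn2r ?nnegrE// (le_trans _ sM).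
Qed.

(** Bounding [|s|] by the square root of [s^2 + e] turns the two powers into one
    with a positive exponent, whatever the sign of [r - q]; the same is done in
    [reg_weight_le]. *)
Lemma reg_mass_le (M : R) s e : 0 < e -> e <= 1 -> `|s| <= M ->
  reg_mass e s <= powR (M ^+ 2 + 1) (r / 2).
Proof.
move=> e0 e1 sM; have w0 := reg_gt0 s e0.
apply: (@le_trans _ _ (powR (reg s e) (q / 2) * powR (reg s e) (gam * q))).
  by apply: ler_wpM2r; rewrite ?powR_ge0 ?norm_le_reg ?ltW.
rewrite -powRD; last by rewrite (gt_eqF w0) implybT.
rewrite gamq (_ : q / 2 + (r - q) / 2 = r / 2); last by field.
apply: powR_homo; [|exact: ltW|exact: reg_le].
by rewrite divr_ge0// ltW.
Qed.

Lemma reg_slope_ge0 s e : 0 < e -> 0 <= reg_slope e s.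
Proof.
move=> e0; rewrite divr_ge0 ?(ltW (reg_gt0 _ _))// addr_ge0 ?(ltW e0)//.
by apply: mulr_ge0; [rewrite divr_ge0 ?ltW|rewrite -expr2 sqr_ge0].
Qed.

Lemma reg_slope_le s e : 0 < e -> reg_slope e s <= 1 + r / q.
Proof.
move=> e0; have w0 := reg_gt0 s e0; rewrite ler_pdivrMr//.
have rq : 0 < r / q by rewrite divr_gt0.
have ss : 0 <= s * s by rewrite -expr2 sqr_ge0.
rewrite /reg; move: (r / q) rq => c rq; have := mulr_ge0 (ltW rq) (ltW e0); lra.
Qed.

Lemma reg_weight_le (M : R) s e : 0 < e -> e <= 1 -> `|s| <= M ->
  reg_weight e s <= powR (M ^+ 2 + 1) ((r - 2) / 2) * (1 + r / q) ^+ 2.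
Proof.
move=> e0 e1 sM; have w0 := reg_gt0 s e0.
apply: ler_pM; [by rewrite mulr_ge0 ?powR_ge0|exact: sqr_ge0| |]; last first.
  by rewrite lerXn2r ?nnegrE ?reg_slope_ge0 ?reg_slope_le// addr_ge0 ?divr_ge0 ?ltW.
apply: (@le_trans _ _ (powR (reg s e) ((q - 2) / 2) * powR (reg s e) (gam * q))).
  by apply: ler_wpM2r; rewrite ?powR_ge0 ?norm_le_reg ?subr_ge0.
rewrite -powRD; last by rewrite (gt_eqF w0) implybT.
rewrite gamq (_ : (q - 2) / 2 + (r - q) / 2 = (r - 2) / 2); last by field.
apply: powR_homo; [|exact: ltW|exact: reg_le].
by rewrite divr_ge0// subr_ge0.
Qed.

Lemma reg_weight_lim_le s : reg_weight_lim s <= (r / q) ^+ 2 * powR `|s| (r - 2).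
Proof.
rewrite /reg_weight_lim; case: eqP => [->|//]; rewrite normr0.
case: eqP => [->|_] /=; last by rewrite mulr_ge0 ?powR_ge0 ?sqr_ge0.
case: eqP => [->|_] /=; last by rewrite mulr_ge0 ?powR_ge0 ?sqr_ge0.
by rewrite subrr powRr0 divff// expr1n mulr1.
Qed.

Lemma reg_weight_lim_ge0 s : 0 <= reg_weight_lim s.
Proof.
rewrite /reg_weight_lim; case: ifP => _; first exact: ler0n.
by rewrite mulr_ge0 ?powR_ge0 ?sqr_ge0.
Qed.

Local Notation eps := (fun k : nat => k.+1%:R^-1 : R).

Lemma eps_gt0 k : 0 < eps k.
Proof. by rewrite invr_gt0. Qed.

Lemma eps_le1 k : eps k <= 1.
Proof. by rewrite invf_le1 ?ltr0n// ler1n. Qed.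

Lemma eps_cvg0 : eps @ \oo --> (0 : R).
Proof. exact: cvg_harmonic. Qed.

Lemma powR_eps_cvg0 (a : R) : 0 < a -> (fun k => powR (eps k) a) @ \oo --> (0 : R).
Proof.
move=> a0; apply/cvgr0Pnorm_le => d d0.
have p0 : 0 < powR d a^-1 by exact: powR_gt0.
near=> k.
rewrite ger0_norm ?powR_ge0//.
have -> : d = powR (powR d a^-1) a by rewrite -powRrM mulVf ?gt_eqF// powRr1// ltW.
apply: powR_homo; rewrite ?(ltW a0) ?(ltW (eps_gt0 k))//.
apply: ltW; near: k; exact: near_infty_natSinv_lt (PosNum p0).
Unshelve. all: by end_near. Qed.

Lemma reg_cvg s : (fun k => reg s (eps k)) @ \oo --> s * s.
Proof.
by rewrite -[X in _ --> X]addr0; apply: cvgD; [exact: cvg_cst|exact: eps_cvg0].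
Qed.

Lemma powR_reg_cvg s (a : R) : s != 0 ->
  (fun k => powR (reg s (eps k)) a) @ \oo --> powR `|s| (2 * a).
Proof.
move=> s0; have ss0 : 0 < s * s by rewrite -expr2 exprn_even_gt0.
have -> : powR `|s| (2 * a) = powR (s * s) a.
  by rewrite powRrM powR2// real_normK ?num_real.
apply: (@cvg_comp _ _ _ (fun k => reg s (eps k)) (fun t => powR t a) _ (nbhs (s * s))).
  exact: reg_cvg.
have : {for s * s, continuous (fun t => powR t a)}.
  apply/differentiable_continuous/derivable1_diffP.
  by case: (is_derive1_powR a ss0).
exact.
Qed.

Lemma reg_mass_cvg s : (fun k => reg_mass (eps k) s) @ \oo --> powR `|s| r.
Proof.
have [->|s0] := eqVneq s 0.
  rewrite normr0 powR0 ?gt_eqF// (_ : (fun k => _) = cst 0); first exact: cvg_cst.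
  by apply/funext => k; rewrite /reg_mass normr0 powR0 ?gt_eqF// mul0r.
have -> : powR `|s| r = powR `|s| q * powR `|s| (2 * (gam * q)).
  rewrite -powRD; last by rewrite normr_eq0 s0 implybT.
  by rewrite gamq; congr (powR _ _); field.
by apply: cvgM; [exact: cvg_cst|exact: powR_reg_cvg].
Qed.

Lemma reg_weight_cvg s : (fun k => reg_weight (eps k) s) @ \oo --> reg_weight_lim s.
Proof.
rewrite /reg_weight_lim; case: eqP => [->|/eqP s0].
  have E k : reg_weight (eps k) 0 = powR 0 (q - 2) * powR (eps k) (gam * q).
    rewrite /reg_weight /reg_slope /reg normr0 mulr0 add0r mulr0 add0r.
    by rewrite divff ?gt_eqF ?eps_gt0// expr1n mulr1.
  rewrite (_ : (fun k => _) = fun k => powR 0 (q - 2) * powR (eps k) (gam * q)); last first.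
    by apply/funext => k; rewrite E.
  have [qE|qN] := eqVneq q 2; last first.
    rewrite powR0 ?subr_eq0//= (_ : (fun k => _) = cst 0); first exact: cvg_cst.
    by apply/funext => k; rewrite mul0r.
  rewrite qE subrr powRr0 -qE gamq qE.
  rewrite (_ : (fun k => _) = fun k => powR (eps k) ((r - 2) / 2)); last first.
    by apply/funext => k; rewrite mul1r.
  have [->|rN] := eqVneq r 2.
    rewrite subrr mul0r/= (_ : (fun k => _) = cst 1); first exact: cvg_cst.
    by apply/funext => k; rewrite powRr0.
  apply: powR_eps_cvg0; rewrite divr_gt0// subr_gt0 lt_neqAle eq_sym rN.
  exact: r2.
have -> : (r / q) ^+ 2 * powR `|s| (r - 2) =
    powR `|s| (q - 2) * powR `|s| (2 * (gam * q)) * (r / q) ^+ 2.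
  rewrite -powRD; last by rewrite normr_eq0 s0 implybT.
  by rewrite mulrC gamq; congr (powR _ _ * _); field.
have ss0 : s * s != 0 by rewrite mulf_neq0.
have slope : (fun k => reg_slope (eps k) s) @ \oo --> r / q.
  have -> : r / q = (r / q * (s * s) + 0) / (s * s) by rewrite addr0 mulfK.
  apply: cvgM; first by apply: cvgD; [exact: cvg_cst|exact: eps_cvg0].
  by apply: cvgV => //; exact: reg_cvg.
apply: cvgM; last first.
  have -> : (fun k => reg_slope (eps k) s ^+ 2) =
      (fun k => reg_slope (eps k) s * reg_slope (eps k) s).
    by apply/funext => k; rewrite expr2.
  by rewrite expr2; exact: cvgM.
by apply: cvgM; [exact: cvg_cst|exact: powR_reg_cvg].
Qed.

End regularised_powers.

(** * Changing the exponent of an energy inequality *)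

Section regularised_test_functions.
Context {R : realType} {n : nat} {Omega : set 'rV[R]_n}.
Variables (q r : R).
Hypotheses (q2 : 2 <= q) (r2 : 2 <= r).
Implicit Types (phi : 'rV[R]_n -> R) (e : R).

Local Notation gam := (reg_exponent q r).

Definition reg_fun phi e (x : 'rV[R]_n) : R :=
  phi x * powR (reg (phi x) e) gam.

Lemma smooth_reg_power phi e (a : R) : 0 < e -> smooth phi ->
  smooth (fun x => powR (reg (phi x) e) a).
Proof.
move=> e0 /smoothP sphi; apply/smoothP => k; apply: Ck_powR.
  by move=> x; exact: reg_gt0.
by apply: CkD; [apply: CkM|exact: Ck_cst].
Qed.

Lemma test_reg_fun phi e : 0 < e -> test_function Omega phi ->
  test_function Omega (reg_fun phi e).
Proof.
by move=> e0 tphi; apply: test_mulr => //; apply: smooth_reg_power => //; case: tphi.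
Qed.

Lemma partial_reg_power phi e (a : R) i x : 0 < e -> smooth phi ->
  partial i (fun y => powR (reg (phi y) e) a) x =
  a * powR (reg (phi x) e) (a - 1) * (2 * phi x * partial i phi x).
Proof.
move=> e0 sphi; have D := smooth_is_derive i x sphi.
have D2 : is_derive x (delta_mx ord0 i : 'rV[R]_n) (fun y => reg (phi y) e)
    (2 * phi x * partial i phi x).
  apply: (is_derive_eq (is_deriveD (is_deriveM D D) (is_derive_cst e x _))).
  by rewrite addr0 /GRing.scale/=; ring.
have := is_derive_comp1 D2 (is_derive1_powR a (reg_gt0 (phi x) e0)).
by case.
Qed.

Lemma gradient_reg_fun phi e x : 0 < e -> smooth phi ->
  gradient (reg_fun phi e) x =
  (powR (reg (phi x) e) gam * reg_slope q r e (phi x)) *: gradient phi x.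
Proof.
move=> e0 sphi; apply/rowP => i; rewrite !mxE.
have w0 := reg_gt0 (phi x) e0.
rewrite (partialM i x sphi (smooth_reg_power gam e0 sphi)).
rewrite partial_reg_power// powRB; last by rewrite (gt_eqF w0) implybT.
rewrite powRr1 ?(ltW w0)// /reg_slope.
have wN : reg (phi x) e != 0 by rewrite gt_eqF.
have qN : q != 0 by rewrite gt_eqF// (lt_le_trans _ q2).
have gE : r / q = 1 + 2 * gam by rewrite /reg_exponent; field.
rewrite gE; move: wN; rewrite /reg; move: (powR _ _) => W wN.
by field.
Qed.

Lemma reg_fun_power phi e x : 0 < e ->
  powR `|reg_fun phi e x| q = reg_mass q r e (phi x).
Proof.
move=> e0; rewrite /reg_fun /reg_mass normrM [`|powR _ _|]ger0_norm ?powR_ge0//.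
by rewrite powRM ?powR_ge0// -powRrM.
Qed.

Lemma reg_fun_energy phi e x : 0 < e -> smooth phi ->
  powR `|reg_fun phi e x| (q - 2) * powR (enorm (gradient (reg_fun phi e) x)) 2 =
  reg_weight q r e (phi x) * powR (enorm (gradient phi x)) 2.
Proof.
move=> e0 sphi; rewrite (gradient_reg_fun x e0 sphi) enormZ.
have w0 := reg_gt0 (phi x) e0.
have c0 : 0 <= powR (reg (phi x) e) gam * reg_slope q r e (phi x).
  by apply: mulr_ge0; [exact: powR_ge0|exact: reg_slope_ge0].
rewrite [`|powR _ _ * _|]ger0_norm//.
rewrite (powR2 (mulr_ge0 c0 (enorm_ge0 _))) (powR2 (enorm_ge0 _)).
rewrite /reg_fun normrM [`|powR _ _|]ger0_norm ?powR_ge0//.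
rewrite powRM ?powR_ge0// -powRrM /reg_weight.
have -> : powR (reg (phi x) e) (gam * q) =
    powR (reg (phi x) e) (gam * (q - 2)) * powR (reg (phi x) e) gam ^+ 2.
  rewrite -powR2 ?powR_ge0// -powRrM -powRD; last by rewrite (gt_eqF w0) implybT.
  by congr powR; ring.
by ring.
Qed.

End regularised_test_functions.

Section bounded_open_set.
Context {R : realType} {n : nat} {Omega : set 'rV[R]_n}.
Hypotheses (oO : open Omega) (bO : bounded_set Omega).

Let mO := measurable_domain oO.

Lemma Rintegral_cvg_bounded (f_ : nat -> 'rV[R]_n -> R) (f : 'rV[R]_n -> R)
    (C : R) :
  (forall k, measurable_fun Omega (f_ k)) ->
  (forall x, (fun k => f_ k x) @ \oo --> f x) ->
  (forall k x, `|f_ k x| <= C) ->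
  measurable_fun Omega f /\
  (fun k => \int[lebesgue_row n]_(x in Omega) f_ k x) @ \oo -->
    (\int[lebesgue_row n]_(x in Omega) f x).
Proof.
move=> mf_ cf fC.
have mf : measurable_fun Omega f.
  by apply: (measurable_fun_cvg (h := f_)) => // x _; exact: cf.
split=> //.
have C0 : 0 <= C by exact: le_trans (normr_ge0 _) (fC 0%N 0).
have iC : (lebesgue_row n).-integrable Omega (fun x => (cst C x)%:E).
  apply: (bounded_integrable oO bO (C := C)) => // x _.
  by rewrite /= ger0_norm.
have [||||ifl _ cv] := @dominated_convergence _ _ _ (lebesgue_row n) Omega mO
  (fun k x => (f_ k x)%:E) (fun x => (f x)%:E) (fun x => (cst C x)%:E) _ _ _ iC.
- by move=> k; exact/measurable_EFinP.
- exact/measurable_EFinP.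
- by apply: aeW => x _; apply: cvg_EFin; [exact: nearW|exact: cf].
- by apply: aeW => x k _; rewrite lee_fin.
apply: (@fine_cvg _ _ _ _ (fun k => \int[lebesgue_row n]_(x in Omega) (f_ k x)%:E)%E).
by rewrite fineK//; exact: integrable_fin_num.
Qed.

(** The substitution [v = |u|^(r/q - 1) u] changes [int |v|^q] into [int |u|^r] and
    [int |v|^(q-2) |grad v|^2] into [(r/q)^2 int |u|^(r-2) |grad u|^2]. The power is
    regularised so that [v] is again a test function, and the regularisation is removed
    by dominated convergence. Taking [q] and [r] arbitrary covers the substitution and
    its inverse. *)
Lemma energy_bound_transfer (q r A B : R) : 2 <= q -> 2 <= r ->
  0 <= A -> 0 <= B -> energy_bound Omega q A B ->
  energy_bound Omega r A (B * (r / q) ^+ 2).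
Proof.
move=> q2 r2 A0 B0 qAB phi tphi.
have sphi := test_smooth tphi.
have [M M0 HM] := test_bounded tphi; have [D D0 HD] := gradient_bounded tphi.
have mphi := test_measurable tphi; have mg := gradient_measurable (Omega := Omega) sphi.
pose eps := fun k : nat => k.+1%:R^-1 : R.
have e0 k : 0 < eps k by exact: eps_gt0.
have e1 k : eps k <= 1 by exact: eps_le1.
have th k := test_reg_fun q r (e0 k) tphi.
have mth k := test_measurable (th k).
have mgth k := gradient_measurable (Omega := Omega) (test_smooth (th k)).
have [] := @Rintegral_cvg_bounded
  (fun k x => powR `|reg_fun q r phi (eps k) x| q)
  (fun x => powR `|phi x| r) (powR (M ^+ 2 + 1) (r / 2)).
- by move=> k; exact: measurable_powR_norm.
- move=> x; under eq_fun do rewrite reg_fun_power//.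
  exact: reg_mass_cvg.
- move=> k x; rewrite ger0_norm ?powR_ge0// reg_fun_power//.
  by apply: reg_mass_le.
move=> _ massC.
have [] := @Rintegral_cvg_bounded
  (fun k x => powR `|reg_fun q r phi (eps k) x| (q - 2) *
              powR (enorm (gradient (reg_fun q r phi (eps k)) x)) 2)
  (fun x => reg_weight_lim q r (phi x) * powR (enorm (gradient phi x)) 2)
  (powR (M ^+ 2 + 1) ((r - 2) / 2) * (1 + r / q) ^+ 2 * powR D 2).
- by move=> k; exact: porous_integrand_measurable.
- move=> x; under eq_fun do rewrite reg_fun_energy//.
  by apply: cvgM; [exact: reg_weight_cvg|exact: cvg_cst].
- move=> k x; rewrite ger0_norm ?mulr_ge0 ?powR_ge0// reg_fun_energy//.
  apply: ler_pM; [|exact: powR_ge0|exact: reg_weight_le|].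
    by apply: mulr_ge0; [apply: mulr_ge0; exact: powR_ge0|exact: sqr_ge0].
  by apply: powR_homo => //; exact: enorm_ge0.
move=> mlim energyC.
have lim_le : A * power_integral Omega r phi <=
    B * \int[lebesgue_row n]_(x in Omega)
      (reg_weight_lim q r (phi x) * powR (enorm (gradient phi x)) 2).
  have c1 : (fun k => A * power_integral Omega q (reg_fun q r phi (eps k))) @ \oo
      --> A * power_integral Omega r phi by apply: cvgM; [exact: cvg_cst|exact: massC].
  have c2 : (fun k => B * porous_energy Omega q (reg_fun q r phi (eps k))
        (gradient (reg_fun q r phi (eps k)))) @ \oo -->
      B * \int[lebesgue_row n]_(x in Omega)
        (reg_weight_lim q r (phi x) * powR (enorm (gradient phi x)) 2).
    by apply: cvgM; [exact: cvg_cst|exact: energyC].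
  apply: (ler_cvg_to c1 c2).
  by apply: nearW => k; exact: qAB (th k).
apply: (le_trans lim_le); rewrite -mulrA; apply: ler_wpM2l => //.
have r0 : 0 < r by exact: lt_le_trans r2.
have [w [wE gE]] := W01p_of_test oO bO r0 tphi.
have iE := porous_integrable oO r2 w; rewrite wE gE in iE.
rewrite /porous_energy -RintegralZl//; apply: le_Rintegral => //.
- apply: le_integrable (integrableZl mO ((r / q) ^+ 2) iE) => //.
    exact/measurable_EFinP.
  move=> x _; rewrite lee_fin ger0_norm; last first.
    by rewrite mulr_ge0 ?reg_weight_lim_ge0 ?powR_ge0.
  rewrite (le_trans _ (ler_norm _))// mulrA ler_wpM2r ?powR_ge0//.
  exact: reg_weight_lim_le.
- exact: (integrableZl mO ((r / q) ^+ 2) iE).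
- move=> x _; rewrite mulrA ler_wpM2r ?powR_ge0//.
  exact: reg_weight_lim_le.
Qed.

End bounded_open_set.

(** * Bump functions *)

Section bump_function.
Context {R : realType} {n : nat}.
Implicit Types (x c : 'rV[R]_n) (r : R).

Definition depth c r x : R := r ^+ 2 - dotv (x - c) (x - c).

Lemma smooth_depth c r : smooth (depth c r).
Proof.
apply/smoothP => k; rewrite /depth /dotv.
have -> : (fun x => r ^+ 2 - \sum_(i < n) (x - c) ord0 i * (x - c) ord0 i) =
    (fun x => r ^+ 2 + \sum_(i <- index_enum 'I_n)
      (-1) * ((x ord0 i + - c ord0 i) * (x ord0 i + - c ord0 i))).
  by apply/funext => x; rewrite -mulr_sumr mulN1r; under eq_bigr do rewrite !mxE.
have cc i : Ck k (fun x : 'rV[R]_n => x ord0 i + - c ord0 i).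
  by apply: CkD; [exact: Ck_coord|exact: Ck_cst].
apply: CkD; first exact: Ck_cst.
by apply: Ck_sum => i; apply: CkM; [exact: Ck_cst|exact: CkM].
Qed.

Lemma partial_depth c r i x : partial i (depth c r) x = - (2 * (x ord0 i - c ord0 i)).
Proof.
have D j : is_derive x (delta_mx ord0 i)
    (fun y : 'rV[R]_n => (y - c) ord0 j * (y - c) ord0 j)
    (2 * (x ord0 j - c ord0 j) * (i == j)%:R).
  have E : (fun y : 'rV[R]_n => (y - c) ord0 j) =
      (fun y => y ord0 j + - c ord0 j).
    by apply/funext => y; rewrite !mxE.
  have H : is_derive x (delta_mx ord0 i) (fun y : 'rV[R]_n => (y - c) ord0 j)
      ((i == j)%:R).
    rewrite E; apply: (is_derive_eq (is_deriveD (is_derive_coord i j x)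
      (is_derive_cst (- c ord0 j) x _))).
    by rewrite addr0.
  apply: (is_derive_eq (is_deriveM H H)).
  by rewrite !mxE /GRing.scale/=; ring.
have := is_deriveB (is_derive_cst (r ^+ 2) x (delta_mx ord0 i)) (is_derive_sum D).
case=> _; rewrite fct_sumE => E.
rewrite /partial; apply: (etrans E); rewrite sub0r; congr (- _).
rewrite (bigD1 i)//= eqxx mulr1 big1 ?addr0// => j ji.
by rewrite eq_sym (negbTE ji) mulr0.
Qed.

Definition bump c r x : R := flat 0 (depth c r x).

Lemma smooth_bump c r : smooth (bump c r).
Proof.
by apply/smoothP => k; apply: Ck_flat; move: k; apply/smoothP; exact: smooth_depth.
Qed.

Lemma partial_bump c r i x :
  partial i (bump c r) x = flat 2 (depth c r x) * - (2 * (x ord0 i - c ord0 i)).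
Proof.
rewrite -(partial_depth c r).
have := is_derive_comp1 (smooth_is_derive i x (smooth_depth c r))
  (is_derive_flat 0 (depth c r x)).
by case=> _; rewrite mul0r subr0.
Qed.

Lemma gradient_bump_eq0 c r x : bump c r x = 0 -> gradient (bump c r) x = 0.
Proof.
move=> b0; have d0 : depth c r x <= 0.
  by rewrite leNgt; apply/negP => /(flat_gt0 0); rewrite -/(bump c r x) b0 ltxx.
by apply/rowP => i; rewrite !mxE partial_bump flat_eq0// mul0r.
Qed.

Lemma depth_ge0_ball c r (e : R) x : 0 < r -> r < e -> 0 <= depth c r x ->
  ball c e x.
Proof.
move=> r0 re; rewrite subr_ge0 -enorm_sqr => d.
rewrite -box_ball ?(lt_trans r0)// => i.
have := coord_le_enorm (x - c) i; rewrite !mxE => /le_lt_trans; apply.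
apply: le_lt_trans re; rewrite -(@ler_pXn2r _ 2)// nnegrE ?enorm_ge0//.
exact: ltW.
Qed.

(** The box is shifted away from the centre, where the gradient of the bump
    vanishes. *)
Lemma depth_gt0_box c r (d : R) x : 0 < r -> d = r / (2 * n.+1%:R) ->
  box (c + const_mx d) d x -> 0 < depth c r x /\ forall i, x ord0 i != c ord0 i.
Proof.
move=> r0 dE bx.
have n0 : (0 : R) < n.+1%:R by rewrite ltr0n.
have d0 : 0 < d by rewrite dE divr_gt0// mulr_gt0.
have h i : 0 < x ord0 i - c ord0 i < 2 * d.
  by have := bx i; rewrite !mxE ltr_distl; lra.
split; last by move=> i; have /andP[+ _] := h i; rewrite subr_gt0 => /gt_eqF ->.
rewrite subr_gt0; apply: (@le_lt_trans _ _ (\sum_(i < n) (2 * d) ^+ 2)).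
  apply: ler_sum => i _; rewrite !mxE -expr2.
  by have /andP[h1 h2] := h i; rewrite lerXn2r ?nnegrE ?ltW// mulr_gt0.
rewrite sumr_const card_ord -[ltLHS]mulr_natl dE.
have -> : (n%:R : R) * (2 * (r / (2 * n.+1%:R))) ^+ 2 =
    r ^+ 2 * (n%:R / n.+1%:R / n.+1%:R).
  by move: n0; move: (n.+1%:R) => m m0; field; rewrite gt_eqF.
rewrite gtr_pMr ?exprn_gt0// ltr_pdivrMr// mul1r.
apply: (@lt_le_trans _ _ 1); last by rewrite ler1n.
by rewrite ltr_pdivrMr// mul1r ltr_nat.
Qed.

(** The second property, a gradient that vanishes wherever the function does, holds
    because all [flat k] vanish at the same points. The third provides integrals of
    [|b|^s |grad b|^t] that are positive for all exponents. *)
Lemma exists_bump (Omega : set 'rV[R]_n) : (0 < n)%N -> open Omega ->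
  Omega !=set0 -> exists b : 'rV[R]_n -> R,
  [/\ test_function Omega b, forall x, b x = 0 -> gradient b x = 0 &
    exists c d, [/\ 0 < d, box c d `<=` Omega &
      forall x, box c d x -> b x != 0 /\ 0 < enorm (gradient b x)]].
Proof.
move=> n_gt0 oO [c Oc].
have : nbhs c Omega by exact: open_nbhs_nbhs.
move=> /nbhs_ballP[e /= e0 eO].
have r0 : 0 < e / 2 by rewrite divr_gt0.
have re : e / 2 < e by rewrite ltr_pdivrMr// ltr_pMr// ltr1n.
pose K := [set x | 0 <= depth c (e / 2) x].
have KO : K `<=` Omega by move=> x Kx; apply: eO; exact: depth_ge0_ball Kx.
have cd : continuous (depth c (e / 2)) by exact/smooth_continuous/smooth_depth.
have cK : compact K.
  apply: bounded_closed_compact.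
    exists (`|c| + e); split; first exact: num_real.
    move=> M cM x Kx; have := depth_ge0_ball r0 re Kx.
    rewrite mx_norm_ball => cx; apply: le_trans (ltW cM).
    rewrite -{1}(subrK c x) addrC (le_trans (ler_normD _ _))// lerD2l.
    by rewrite distrC ltW.
  apply: (@preimage_closed _ _ (depth c (e / 2)) [set t | 0 <= t]) => //.
exists (bump c (e / 2)); split.
- split; first exact: smooth_bump.
  exists K; split=> // x /negP; rewrite -ltNge => dx.
  by rewrite /bump flat_eq0// ltW.
- by move=> x; exact: gradient_bump_eq0.
- pose d := e / 2 / (2 * n.+1%:R).
  exists (c + const_mx d), d; split.
  + by rewrite divr_gt0// mulr_gt0// ltr0n.
  + by move=> x /(depth_gt0_box r0 erefl)[dx _]; apply: KO; exact: ltW.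
  + move=> x /(depth_gt0_box r0 erefl)[dx xc]; split.
      by rewrite gt_eqF// flat_gt0.
    pose i := Ordinal n_gt0.
    apply: lt_le_trans (coord_le_enorm _ i).
    rewrite mxE partial_bump normr_gt0 mulf_neq0//.
      by rewrite gt_eqF// flat_gt0.
    rewrite oppr_eq0 mulf_neq0//.
    by rewrite subr_eq0; exact: xc.
Qed.

End bump_function.

(** * Eigenvalue quotients *)

Section extended_quotients.
Context {R : realType}.
Local Open Scope ereal_scope.
Implicit Types (x y : \bar R) (A B : set (\bar R)).

Lemma eq_ereal_inf_le A B : (forall x, A x -> exists2 y, B y & y <= x) ->
  (forall y, B y -> exists2 x, A x & x <= y) -> ereal_inf A = ereal_inf B.
Proof.
move=> AB BA; apply/eqP; rewrite eq_le; apply/andP; split; apply/ereal_infP.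
  by move=> y /BA[x Ax xy]; apply: le_trans xy; exact: ereal_inf_lbound.
by move=> x /AB[y By yx]; apply: le_trans yx; exact: ereal_inf_lbound.
Qed.

Lemma ereal_inf_finite A : (forall x, A x -> 0 <= x) ->
  (exists2 x, A x & x < +oo) -> exists2 r : R, (0 <= r)%R & ereal_inf A = r%:E.
Proof.
move=> A0 [x Ax xoo].
have i0 : 0 <= ereal_inf A by exact/ereal_infP.
have ioo : ereal_inf A < +oo by apply: le_lt_trans xoo; exact: ereal_inf_lbound.
have ifin : ereal_inf A \is a fin_num by rewrite ge0_fin_numE.
by exists (fine (ereal_inf A)); [exact: fine_ge0|rewrite fineK].
Qed.

Lemma poweR_inv x (s : R) : (0 < s)%R -> 0 <= x -> poweR (inve x) s = inve (poweR x s).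
Proof.
move=> s0; case: x => [x| |]//; rewrite ?lee_fin => x0; last first.
  by rewrite invey poweR0r ?poweRyr ?gt_eqF// invey.
have [->|xN] := eqVneq x 0%R.
  by rewrite inve0 poweRyr ?poweR0r ?gt_eqF// inve0.
rewrite inver (negbTE xN) !poweR_EFin inver powR_eq0 (negbTE xN)/=.
congr EFin; have x1 : (0 < x)%R by rewrite lt_neqAle eq_sym xN.
by rewrite -powR_inv1 ?(ltW x1)// powRAC powR_inv1// powR_ge0.
Qed.

Lemma poweR_div x y (s : R) : (0 < s)%R -> 0 <= x -> 0 <= y ->
  poweR (x / y) s = poweR x s / poweR y s.
Proof. by move=> s0 x0 y0; rewrite poweRM ?inve_ge0// poweR_inv. Qed.

(** The conventions [1/0 = +oo] and [1/+oo = 0] are compatible with scaling. *)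
Lemma divZe (c : R) x y : (0 < c)%R -> 0 <= y ->
  (c%:E * x) / (c%:E * y) = x / y.
Proof.
move=> c0; case: y => [y| |]//; rewrite ?lee_fin => y0; last first.
  by rewrite gt0_muley ?lte_fin// invey !mule0.
have [->|yN] := eqVneq y 0%R.
  rewrite mule0 inve0; case: x => [x| |].
  - rewrite -EFinM; have [x0|x0|->] := ltgtP x 0%R.
    + by rewrite !lt0_muley// lte_fin pmulr_rlt0.
    + by rewrite !gt0_muley// lte_fin mulr_gt0.
    + by rewrite mulr0.
  - by rewrite [(c%:E * +oo)%E]gt0_muley ?lte_fin.
  - by rewrite [(c%:E * -oo)%E]gt0_muleNy ?lte_fin.
rewrite -EFinM !inver mulf_eq0 (gt_eqF c0) (negbTE yN)/= invfM.
case: x => [x| |].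
- by rewrite -!EFinM; congr EFin; rewrite mulrACA divff ?gt_eqF// mul1r.
- rewrite gt0_muley ?lte_fin//.
  by rewrite !gt0_mulye ?lte_fin ?mulr_gt0 ?invr_gt0// lt_neqAle eq_sym yN.
- rewrite gt0_muleNy ?lte_fin//.
  by rewrite !gt0_mulNye ?lte_fin ?mulr_gt0 ?invr_gt0// lt_neqAle eq_sym yN.
Qed.

Lemma le_div2l x y z : 0 <= x -> 0 <= y -> y <= z -> x / z <= x / y.
Proof.
move=> x0 y0 yz; apply: lee_wpmul2l => //.
case: z y y0 yz => [z| |] [y| |]//; rewrite ?lee_fin.
- move=> y0 yz; rewrite !inver.
  have [_|yN] := eqVneq y 0%R; first by rewrite leey.
  have y1 : (0 < y)%R by rewrite lt_neqAle eq_sym yN.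
  have z1 := lt_le_trans y1 yz.
  by rewrite (gt_eqF z1) lee_fin lef_pV2.
- by move=> y0 _; rewrite invey inve_ge0 lee_fin.
Qed.

End extended_quotients.

Section bounded_open_set.
Context {R : realType} {n : nat} {Omega : set 'rV[R]_n}.
Hypotheses (oO : open Omega) (bO : bounded_set Omega).

Let mO := measurable_domain oO.
Local Notation mu := (lebesgue_row n).
Local Notation P := (power_integral Omega).
Local Notation N := (gradient_integral Omega).
Local Notation E := (porous_energy Omega).

Lemma integral_gt0_box (f : 'rV[R]_n -> R) c d : measurable_fun Omega f ->
  (forall x, Omega x -> 0 <= f x) -> 0 < d -> box c d `<=` Omega ->
  (forall x, box c d x -> 0 < f x) -> (0 < \int[mu]_(x in Omega) (f x)%:E)%E.
Proof.
move=> mf f0 d0 bO' fb.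
have i0 : (0 <= \int[mu]_(x in Omega) (f x)%:E)%E.
  by apply: integral_ge0 => x Ox; rewrite lee_fin f0.
rewrite lt_neqAle i0 andbT eq_sym; apply/eqP => /= I0.
have mf' : measurable_fun Omega (EFin \o f) by exact/measurable_EFinP.
have : (\int[mu]_(x in Omega) `|(f x)%:E| = 0)%E.
  rewrite -I0; apply: eq_integral => x; rewrite inE => Ox.
  by rewrite gee0_abs ?lee_fin ?f0.
move/(ae_eq_integral_abs mu mO mf') => [M [mM M0 sub]].
have : (mu (box c d) <= mu M)%E.
  apply: le_measure; rewrite ?inE//; first exact: measurable_box.
  move=> x bx; apply: sub => /= H; have := fb x bx.
  by move: (H (bO' x bx)) => /= [->]; rewrite ltxx.
rewrite [X in (_ <= X)%E]M0 [X in (X <= _)%E]lebesgue_row_box// lee_fin leNgt.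
by rewrite exprn_gt0// mulrn_wgt0.
Qed.

Section exponent.
Variable p : R.
Hypothesis p2 : 2 <= p.
Implicit Type w : W01p Omega p.

Let p0 : 0 < p. Proof. exact: lt_le_trans p2. Qed.
Let ip0 : 0 < p^-1. Proof. by rewrite invr_gt0. Qed.
Let p1 : 1 <= p. Proof. by rewrite (le_trans _ p2)// ler1n. Qed.

Lemma power_integralE w :
  (\int[mu]_(x in Omega) (powR `|w x| p)%:E = (P p w)%:E)%E.
Proof. by rewrite fineK//; exact: integrable_fin_num (W01p_integrable p0 w). Qed.

Lemma gradient_integralE w :
  (\int[mu]_(x in Omega) (powR (enorm (nabla w x)) p)%:E = (N p (nabla w))%:E)%E.
Proof. by rewrite fineK//; exact: integrable_fin_num (W01p_integrable_nabla p0 w). Qed.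

Lemma porous_energyE w :
  (\int[mu]_(x in Omega) (powR `|w x| (p - 2) * powR (enorm (nabla w x)) 2)%:E =
   (E p w (nabla w))%:E)%E.
Proof. by rewrite fineK//; exact: integrable_fin_num (porous_integrable oO p2 w). Qed.

Lemma Lp_normE w : Lp_norm Omega p w = (powR (P p w) p^-1)%:E.
Proof. by rewrite /Lp_norm power_integralE. Qed.

Lemma Lp_norm_nablaE w :
  Lp_norm Omega p (enorm \o nabla w) = (powR (N p (nabla w)) p^-1)%:E.
Proof.
have I : (\int[mu]_(x in Omega) (powR `|(enorm \o nabla w) x| p)%:E =
    (N p (nabla w))%:E)%E.
  rewrite -gradient_integralE; apply: eq_integral => x _.
  by rewrite /= ger0_norm// enorm_ge0.
by rewrite /Lp_norm I.
Qed.

Lemma sobolev_normE w :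
  sobolev_norm Omega p w (nabla w) = (powR (P p w + N p (nabla w)) p^-1)%:E.
Proof. by rewrite /sobolev_norm power_integralE gradient_integralE. Qed.

Lemma ae_power_integral w :
  {ae mu, forall x, Omega x -> w x = 0} <-> P p w = 0.
Proof.
have mw := W01p_measurable w.
have mpw : measurable_fun Omega (fun x => (powR `|w x| p)%:E).
  by apply/measurable_EFinP; exact: measurable_powR_norm.
have abs : (\int[mu]_(x in Omega) `|(powR `|w x| p)%:E| = (P p w)%:E)%E.
  rewrite -power_integralE; apply: eq_integral => x _.
  by rewrite gee0_abs// lee_fin powR_ge0.
have pw0 x : powR `|w x| p = 0 -> w x = 0.
  by move=> /powR_eq0_eq0/eqP; rewrite normr_eq0 => /eqP.
split=> [ae0|P0].
  have : ae_eq mu Omega (fun x => (powR `|w x| p)%:E) (cst 0%E).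
    by apply: filterS ae0 => x h Ox; rewrite h// normr0 powR0// gt_eqF.
  by move/(ae_eq_integral_abs mu mO mpw); rewrite abs => -[].
have : (\int[mu]_(x in Omega) `|(powR `|w x| p)%:E| = 0)%E by rewrite abs P0.
move/(ae_eq_integral_abs mu mO mpw); apply: filterS => x h Ox.
by apply: pw0; have := h Ox => -[].
Qed.

Lemma nonzeroP w : nonzero w <-> 0 < P p w.
Proof.
split=> [nz|P0].
  rewrite lt_neqAle power_integral_ge0 andbT eq_sym; apply/eqP => P0.
  by apply: nz; exact/ae_power_integral.
by move/ae_power_integral => P00; rewrite P00 ltxx in P0.
Qed.

Lemma minus_plaplacianE w : minus_plaplacian w w = (N p (nabla w))%:E.
Proof.
rewrite -gradient_integralE; apply: eq_integral => x _; congr EFin.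
rewrite -enorm_sqr -powR2 ?enorm_ge0// powR_mulD ?enorm_ge0 ?subr_ge0//.
by rewrite subrK.
Qed.

Lemma porous_operatorE w : porous_operator w w = (E p w (nabla w))%:E.
Proof.
rewrite -porous_energyE; apply: eq_integral => x _; congr EFin.
by rewrite -enorm_sqr -powR2// enorm_ge0.
Qed.

Lemma power_operatorE w : power_operator w w = (P p w)%:E.
Proof.
rewrite -power_integralE; apply: eq_integral => x _; congr EFin.
rewrite -mulrA -expr2 -real_normK ?num_real// -powR2// powR_mulD ?subr_ge0//.
by rewrite subrK.
Qed.

Section mixed.
Variables a b : R.
Hypotheses (a0 : 0 <= a) (b0 : 0 <= b) (ab : a + b = p).

Definition mixed_integral w : \bar R :=
  \int[mu]_(x in Omega) (powR `|w x| a * powR (enorm (nabla w x)) b)%:E.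

Lemma mixed_integral_ge0 w : (0 <= mixed_integral w)%E.
Proof. by apply: integral_ge0 => x _; rewrite lee_fin mulr_ge0 ?powR_ge0. Qed.

Lemma mixed_integrandE (u e : R) :
  powR `|u| (a - 2) * u * e * u = if u == 0 then 0 else powR `|u| a * e.
Proof.
case: eqP => [->|/eqP u0]; first by rewrite mulr0.
have -> : powR `|u| (a - 2) * u * e * u = powR `|u| (a - 2) * (u ^+ 2) * e by ring.
rewrite -real_normK ?num_real// -powR2// -powRD ?subrK//.
by rewrite normr_eq0 u0 implybT.
Qed.

Lemma mixed_operator_ge0 w : (0 <= mixed_operator a b w w)%E.
Proof.
apply: integral_ge0 => x _; rewrite lee_fin mixed_integrandE.
by case: ifP => // _; rewrite mulr_ge0 ?powR_ge0.
Qed.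

Lemma mixed_integrand_measurable w :
  measurable_fun Omega (fun x => powR `|w x| a * powR (enorm (nabla w x)) b).
Proof.
apply: measurable_funM.
  by apply: measurable_powR_norm; exact: W01p_measurable.
by apply: measurable_powR_enorm; exact: W01p_measurable_nabla.
Qed.

Lemma mixed_operator_le w : (mixed_operator a b w w <= mixed_integral w)%E.
Proof.
apply: ge0_le_integral => //.
- move=> x _; rewrite lee_fin mixed_integrandE.
  by case: ifP => // _; rewrite mulr_ge0 ?powR_ge0.
- have mw := W01p_measurable w.
  apply/measurable_EFinP; do 2 (apply: measurable_funM => //).
    by apply: measurable_funM => //; exact: measurable_powR_norm.
  by apply: measurable_powR_enorm; exact: W01p_measurable_nabla.
- by apply/measurable_EFinP; exact: mixed_integrand_measurable.
- move=> x _; rewrite lee_fin mixed_integrandE.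
  by case: ifP => // _; rewrite mulr_ge0 ?powR_ge0.
Qed.

(** The integrands differ only where [u = 0], and there only if the exponent of
    [u] is 0. *)
Lemma mixed_operatorE w : (forall x, w x = 0 -> a = 0 -> nabla w x = 0 /\ b != 0) ->
  mixed_operator a b w w = mixed_integral w.
Proof.
move=> H; apply: eq_integral => x _; rewrite mixed_integrandE; congr EFin.
case: eqP => // wx; have [a00|aN] := eqVneq a 0.
  by have [-> bN] := H x wx a00; rewrite enorm0 powR0// mulr0.
by rewrite wx normr0 powR0// mul0r.
Qed.

Definition mixed_quotient w : \bar R :=
  (Lp_norm Omega p (enorm \o nabla w) / poweR (mixed_integral w) p^-1)%E.

Definition mixed_operator_quotient w : \bar R :=
  poweR (minus_plaplacian w w / mixed_operator a b w w)%E p^-1.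

Lemma mixed_operator_quotientE w : mixed_operator_quotient w =
  (Lp_norm Omega p (enorm \o nabla w) / poweR (mixed_operator a b w w) p^-1)%E.
Proof.
rewrite /mixed_operator_quotient minus_plaplacianE poweR_div//.
- by rewrite Lp_norm_nablaE poweR_EFin.
- by rewrite lee_fin gradient_integral_ge0.
- exact: mixed_operator_ge0.
Qed.

Lemma mixed_quotient_le w : (mixed_quotient w <= mixed_operator_quotient w)%E.
Proof.
rewrite mixed_operator_quotientE; apply: le_div2l; rewrite ?poweR_ge0//.
apply: gt0_ler_poweR; rewrite ?in_itv/= ?leey ?andbT ?mixed_operator_ge0
  ?mixed_integral_ge0//.
  exact: ltW.
exact: mixed_operator_le.
Qed.

Lemma mixed_quotient_ge0 w : (0 <= mixed_quotient w)%E.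
Proof. by rewrite mule_ge0 ?inve_ge0 ?poweR_ge0. Qed.

(** Numerator and denominator are both homogeneous of degree 1. *)
Lemma mixed_quotientZ w w' (c : R) : 0 < c -> (W01p_fun w' = fun x => c * w x) ->
  (nabla w' = fun x => c *: nabla w x) -> mixed_quotient w' = mixed_quotient w.
Proof.
move=> c0 wE gE.
have -> : mixed_quotient w' =
    (poweR (powR c p)%:E p^-1 * Lp_norm Omega p (enorm \o nabla w) /
     (poweR (powR c p)%:E p^-1 * poweR (mixed_integral w) p^-1))%E.
  rewrite /mixed_quotient -poweRM ?lee_fin ?powR_ge0 ?mixed_integral_ge0//.
  congr (_ / poweR _ _)%E.
    rewrite !Lp_norm_nablaE poweR_EFin -EFinM; congr EFin.
    rewrite -powRM ?powR_ge0 ?gradient_integral_ge0//; congr powR.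
    rewrite /gradient_integral gE -RintegralZl//; last exact: W01p_integrable_nabla.
    by apply: eq_Rintegral => x _; rewrite powR_enormZ.
  rewrite /mixed_integral wE gE -ge0_integral_powRZ//; last 2 first.
  - exact: mixed_integrand_measurable.
  - by move=> x; rewrite mulr_ge0 ?powR_ge0.
  apply: eq_integral => x _; congr EFin.
  rewrite enormZ normrM (ger0_norm (ltW c0)) !powRM ?(ltW c0) ?enorm_ge0//.
  have -> : powR c p = powR c a * powR c b by rewrite powR_mulD ?ab// ltW.
  by ring.
by rewrite poweR_EFin divZe ?poweR_ge0// powR_gt0// powR_gt0.
Qed.

Lemma normalise w : nonzero w -> exists w', unit_sphere w' /\
  mixed_quotient w' = mixed_quotient w.
Proof.
move=> /nonzeroP P0.
have s0 : 0 < powR (P p w + N p (nabla w)) p^-1.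
  by apply: powR_gt0; apply: ltr_pwDl => //; exact: gradient_integral_ge0.
have c0 : 0 < (powR (P p w + N p (nabla w)) p^-1)^-1 by rewrite invr_gt0.
have [w' [wE gE]] := W01pZ oO bO p1 c0 w.
exists w'; split; last exact: mixed_quotientZ wE gE.
rewrite /unit_sphere/= wE gE sobolev_normZ//.
- by rewrite sobolev_normE -EFinM mulVf// gt_eqF.
- exact: W01p_measurable.
- exact: W01p_measurable_nabla.
Qed.

End mixed.

End exponent.

End bounded_open_set.

(** * The two eigenvalues *)

Section bounded_open_set.
Context {R : realType} {n : nat} {Omega : set 'rV[R]_n}.
Hypotheses (n_gt0 : (0 < n)%N) (oO : open Omega) (nO : Omega !=set0)
  (bO : bounded_set Omega).

Let mO := measurable_domain oO.
Local Notation mu := (lebesgue_row n).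
Local Notation P := (power_integral Omega).
Local Notation N := (gradient_integral Omega).
Local Notation E := (porous_energy Omega).

Lemma exists_W01p_bump (p : R) : 0 < p -> exists w : W01p Omega p,
  (forall x, w x = 0 -> nabla w x = 0) /\
  forall a b, (0 < mixed_integral a b w)%E.
Proof.
move=> p0; have [phi [tphi zphi [c [d [d0 bO' pos]]]]] := exists_bump n_gt0 oO nO.
have [w [wE gE]] := W01p_of_test oO bO p0 tphi.
exists w; split=> [x|a b]; rewrite ?wE ?gE; first exact: zphi.
apply: (integral_gt0_box oO _ _ d0 bO').
- exact: mixed_integrand_measurable.
- by move=> x _; rewrite mulr_ge0 ?powR_ge0.
- move=> x bx; rewrite wE gE; have [h1 h2] := pos x bx.
  by rewrite mulr_gt0 ?powR_gt0 ?normr_gt0.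
Qed.

(** The two quotients of a non-zero element agree if [a > 0], and normalising an
    element does not change its quotient. What remains are two degenerate cases. On the
    sphere an element that vanishes almost everywhere has quotient [+oo]. If [a = 0], the
    quotient on the sphere is 1, unless the gradient vanishes almost everywhere and both
    quotients are 0; and a bump function has quotient 1 for both definitions. *)
Lemma mixed_eigenvalue (p a b : R) : 2 <= p -> 0 <= a -> 0 <= b -> a + b = p ->
  exists2 lambda : R,
    first_eigenvalue_root (Omega := Omega) (p := p)
      minus_plaplacian (mixed_operator a b) = lambda%:E &
    ereal_inf [set mixed_quotient a b u | u in unit_sphere (Omega := Omega) (p := p)]
      = lambda%:E.
Proof.
move=> p2 a0 b0 ab.
have p0 : 0 < p by exact: lt_le_trans p2.
have [w [zw pw]] := exists_W01p_bump p0.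
have wE : mixed_operator a b w w = mixed_integral a b w.
  apply: mixed_operatorE => x wx a00; split; first exact: zw.
  by move: ab; rewrite a00 add0r => ->; rewrite gt_eqF.
have QE : mixed_operator_quotient a b w = mixed_quotient a b w.
  by rewrite mixed_operator_quotientE// wE.
have nw : nonzero w.
  apply/(nonzeroP oO p2); rewrite -lte_fin -(power_integralE oO p2).
  have := pw p 0; congr (_ < _)%E; apply: eq_integral => x _.
  by rewrite powRr0 mulr1.
pose S := [set mixed_operator_quotient a b u | u in [set u : W01p Omega p | nonzero u]].
have SE : first_eigenvalue_root (Omega := Omega) (p := p)
    minus_plaplacian (mixed_operator a b) = ereal_inf S.
  congr ereal_inf; rewrite predeqE => y; split.
    by move=> [_ [u nu <-] <-]; exists u.
  move=> [u nu <-].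
  by exists (minus_plaplacian u u / mixed_operator a b u u)%E => //; exists u.
have [||lambda _ SL] := @ereal_inf_finite _ S.
- by move=> _ [u _ <-]; exact: poweR_ge0.
- exists (mixed_operator_quotient a b w); first by exists w.
  rewrite QE /mixed_quotient (Lp_norm_nablaE oO p2).
  have : (poweR (mixed_integral a b w) p^-1 != 0)%E.
    by rewrite gt_eqF// poweR_gt0.
  have := poweR_ge0 (mixed_integral a b w) p^-1.
  case: (poweR _ _) => [y| |]//= y0 yN; last by rewrite invey mule0 ltry.
  by rewrite inver ifF ?ltry//; exact: negbTE.
exists lambda; rewrite ?SE ?SL//; rewrite -SL.
apply: eq_ereal_inf_le => [_ [u su <-]|_ [u nu <-]]; last first.
  have [u' [su' uE]] := normalise oO bO p2 a0 b0 ab nu.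
  exists (mixed_quotient a b u'); first exact: (ex_intro2 _ _ u' su' erefl).
  rewrite uE; exact: mixed_quotient_le.
have sphere : powR (P p u + N p (nabla u)) p^-1 = 1.
  by apply: EFin_inj; rewrite -(sobolev_normE oO p2).
have PN : P p u + N p (nabla u) = 1.
  have PN0 : 0 <= P p u + N p (nabla u).
    by rewrite addr_ge0 ?power_integral_ge0 ?gradient_integral_ge0.
  rewrite -[LHS](powRr1 PN0) -[X in powR _ X](mulVf (lt0r_neq0 p0)).
  by rewrite powRrM sphere powR1.
have [aE|aN] := eqVneq a 0.
  have bE : b = p by rewrite -ab aE add0r.
  have ME v : mixed_integral a b (v : W01p Omega p) = (N p (nabla v))%:E.
    rewrite -(gradient_integralE oO p2); apply: eq_integral => x _.
    by rewrite aE powRr0 mul1r bE.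
  have QvE (v : W01p Omega p) : N p (nabla v) != 0 -> mixed_quotient a b v = 1%E.
    move=> NN; rewrite /mixed_quotient ME (Lp_norm_nablaE oO p2) poweR_EFin.
    have N0 : powR (N p (nabla v)) p^-1 != 0 by rewrite powR_eq0 (negbTE NN).
    by rewrite inver (negbTE N0) -EFinM divff.
  have [N0|NN] := eqVneq (N p (nabla u)) 0.
    exists (mixed_operator_quotient a b u).
      exists u => //; apply/(nonzeroP oO p2).
      by have -> : P p u = 1 by rewrite -PN N0 addr0.
    rewrite mixed_operator_quotientE// (Lp_norm_nablaE oO p2) N0 powR0 ?invr_eq0 ?gt_eqF//.
    by rewrite mul0e mixed_quotient_ge0.
  exists (mixed_operator_quotient a b w); first by exists w.
  have Nw : N p (nabla w) != 0.
    by have := pw a b; rewrite ME lte_fin; exact: lt0r_neq0.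
  by rewrite QE (QvE _ Nw) (QvE _ NN) lexx.
have ue : mixed_operator a b u u = mixed_integral a b u.
  by apply: mixed_operatorE => x _ /eqP; rewrite (negbTE aN).
have [P0|PN0] := eqVneq (P p u) 0; last first.
  exists (mixed_operator_quotient a b u); last by rewrite mixed_operator_quotientE// ue.
  exists u => //; apply/(nonzeroP oO p2).
  by rewrite lt_neqAle eq_sym PN0 power_integral_ge0.
exists (mixed_operator_quotient a b w); first by exists w.
have M0 : mixed_integral a b u = 0%E.
  rewrite -[RHS](integral0 mu Omega).
  apply: ae_eq_integral => //.
  - by apply/measurable_EFinP; exact: mixed_integrand_measurable.
  - have /(ae_power_integral oO p2) := P0; apply: filterS => x h Ox.
    by rewrite h// normr0 powR0// mul0r.
rewrite [leRHS]/mixed_quotient M0 (Lp_norm_nablaE oO p2).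
have -> : N p (nabla u) = 1 by rewrite -PN P0 add0r.
by rewrite powR1 poweR0r ?invr_eq0 ?gt_eqF// inve0 mul1e leey.
Qed.

(** Each of the two eigenvalues is the largest constant in an energy inequality,
    for the exponent [p] and for the exponent 2; [energy_bound_transfer] takes either
    inequality to the other one, and [energy_bound_W01p] brings both back from test
    functions to the Sobolev spaces. *)
Lemma porous_eigenvalue (p : R) : 2 <= p -> exists lambda nu : R,
  [/\ lambda%:E = first_eigenvalue (Omega := Omega) (p := p)
                    porous_operator power_operator,
      nu%:E = lambda1_laplacian Omega &
      lambda = (2 / p * nu) ^+ 2].
Proof.
move=> p2.
have p0 : 0 < p by exact: lt_le_trans p2.
have [w [_ pw]] := exists_W01p_bump p0.
have [v [_ pv]] := exists_W01p_bump (ltr0Sn R 1).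
have nz q (q2 : 2 <= q) (u : W01p Omega q) :
    (0 < mixed_integral q 0 u)%E -> 0 < P q u.
  rewrite -lte_fin -(power_integralE oO q2); congr (_ < _)%E; apply: eq_integral => x _.
  by rewrite powRr0 mulr1.
have EN (u : W01p Omega 2) : E 2 u (nabla u) = N 2 (nabla u).
  by apply: eq_Rintegral => x _; rewrite subrr powRr0 mul1r.
have quotE (u : W01p Omega p) : nonzero u ->
    (porous_operator u u / power_operator u u)%E = (E p u (nabla u) / P p u)%:E.
  move=> /(nonzeroP oO p2) P0.
  by rewrite (porous_operatorE oO p2) (power_operatorE oO p2) inver gt_eqF// -EFinM.
have quot2E (u : W01p Omega 2) : nonzero u ->
    (Lp_norm Omega 2 (enorm \o nabla u) / Lp_norm Omega 2 u)%E =
    (Num.sqrt (N 2 (nabla u) / P 2 u))%:E.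
  move=> /(nonzeroP oO (lexx 2)) P0.
  rewrite (Lp_norm_nablaE oO (lexx 2)) (Lp_normE oO (lexx 2)) inver gt_eqF ?powR_gt0//.
  rewrite -EFinM !powR12_sqrt ?gradient_integral_ge0 ?(ltW P0)//.
  by rewrite sqrtrM ?gradient_integral_ge0// sqrtrV// ltW.
have [||lambda l0 lE] := @ereal_inf_finite _
    (quotients (Omega := Omega) (p := p) porous_operator power_operator).
- move=> _ [u nu <-]; rewrite quotE// lee_fin divr_ge0 ?power_integral_ge0//.
  exact: porous_energy_ge0.
- have nw : nonzero w by apply/(nonzeroP oO p2); exact: nz.
  exists (porous_operator w w / power_operator w w)%E; first by exists w.
  by rewrite quotE// ltry.
have [||nu nu0 nuE] := @ereal_inf_finite _
  [set (Lp_norm Omega 2 (enorm \o nabla v) / Lp_norm Omega 2 v)%E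
            | v in [set v : W01p Omega 2 | nonzero v]].
- by move=> _ [u nu <-]; rewrite quot2E// lee_fin sqrtr_ge0.
- have nv : nonzero v by apply/(nonzeroP oO (lexx 2)); exact: nz.
  exists (Lp_norm Omega 2 (enorm \o nabla v) / Lp_norm Omega 2 v)%E; first by exists v.
  by rewrite quot2E// ltry.
exists lambda, nu; split; [by rewrite -lE|by rewrite -nuE|].
have P0W q (q2 : 2 <= q) (u : W01p Omega q) : ~ nonzero u -> P q u = 0.
  move=> nzu; apply/eqP; apply: contra_notT nzu => PN0; apply/(nonzeroP oO q2).
  by rewrite lt_neqAle eq_sym PN0 power_integral_ge0.
have lP (u : W01p Omega p) : lambda * P p u <= E p u (nabla u).
  have [nzu|/(P0W _ p2)->] := pselect (nonzero u); last first.
    by rewrite mulr0 porous_energy_ge0.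
  have Pu := (nonzeroP oO p2 u).1 nzu; rewrite -ler_pdivlMr// -lee_fin -quotE// -lE.
  by apply: ereal_inf_lbound; exists u.
have nP (u : W01p Omega 2) : nu ^+ 2 * P 2 u <= N 2 (nabla u).
  have [nzu|/(P0W _ (lexx 2))->] := pselect (nonzero u); last first.
    by rewrite mulr0 gradient_integral_ge0.
  have Pu := (nonzeroP oO (lexx 2) u).1 nzu; rewrite -ler_pdivlMr//.
  rewrite -[leRHS]sqr_sqrtr ?divr_ge0 ?gradient_integral_ge0 ?(ltW Pu)//.
  rewrite lerXn2r ?nnegrE ?sqrtr_ge0// -lee_fin -quot2E// -nuE.
  by apply: ereal_inf_lbound; exists u.
have bnd2 : energy_bound Omega 2 (nu ^+ 2) 1.
  move=> phi tphi; have [u [uE gE]] := W01p_of_test oO bO (ltr0Sn R 1) tphi.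
  by rewrite mul1r -gE -uE EN.
have bndp : energy_bound Omega p lambda 1.
  move=> phi tphi; have [u [uE gE]] := W01p_of_test oO bO p0 tphi.
  by rewrite mul1r -gE -uE.
have T2p := energy_bound_transfer oO bO (lexx 2) p2 (sqr_ge0 nu) ler01 bnd2.
have Tp2 := energy_bound_transfer oO bO p2 (lexx 2) l0 ler01 bndp.
have p20 : 0 < (p / 2) ^+ 2 by rewrite exprn_gt0// divr_gt0.
have p20' : 0 < (2 / p) ^+ 2 by rewrite exprn_gt0// divr_gt0.
have inv : (2 / p) ^+ 2 = ((p / 2) ^+ 2)^-1 by rewrite -exprVn invf_div.
rewrite mul1r in T2p; rewrite mul1r in Tp2.
apply/eqP; rewrite eq_le; apply/andP; split.
  have h : p / 2 * Num.sqrt lambda <= nu.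
    rewrite -lee_fin -nuE; apply/ereal_infP => _ [u nzu <-].
    rewrite quot2E// lee_fin.
    have Pu := (nonzeroP oO (lexx 2) u).1 nzu.
    have := energy_bound_W01p oO bO (lexx 2) u l0 (ltW p20') Tp2.
    rewrite EN inv ler_pdivlMl// mulrA -ler_pdivlMr// => h.
    rewrite -[p / 2]gtr0_norm ?divr_gt0// -sqrtr_sqr -sqrtrM ?sqr_ge0//.
    exact: ler_wsqrtr.
  have {}h : Num.sqrt lambda <= 2 / p * nu.
    by rewrite -[2 / p]invf_div ler_pdivlMl// divr_gt0.
  rewrite -[leLHS]sqr_sqrtr// lerXn2r ?nnegrE ?sqrtr_ge0//.
  by rewrite mulr_ge0// divr_ge0// ltW.
rewrite -lee_fin -lE; apply/ereal_infP => _ [u nzu <-].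
rewrite quotE// lee_fin.
have Pu := (nonzeroP oO p2 u).1 nzu.
have := energy_bound_W01p oO bO p2 u (sqr_ge0 nu) (ltW p20) T2p.
by move=> h; rewrite ler_pdivlMr// exprMn inv -mulrA ler_pdivrMl.
Qed.

End bounded_open_set.

Theorem proposition1 (R : realType) (n : nat) (Omega : set 'rV[R]_n) (p : R)
    (n_ge1 : (1 <= n)%N) (domOmega : bounded_domain Omega)
    (smoothOmega : C1_boundary Omega) (p_ge2 : 2 <= p) :
  (forall p0 p1 : R, 0 <= p0 -> 0 <= p1 -> p0 + p1 = p ->
     exists lambda : R,
       lambda%:E = first_eigenvalue_root (Omega := Omega) (p := p)
                     minus_plaplacian (mixed_operator p0 p1) /\
       lambda%:E = ereal_inf
         [set (Lp_norm Omega p (enorm \o nabla u) /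
               poweR (\int[lebesgue_row n]_(x in Omega)
                        (powR `|u x| p0 * powR (enorm (nabla u x)) p1)%:E)
                     p^-1)%E
         | u in unit_sphere (Omega := Omega) (p := p)]) /\
  (exists lambda mu : R,
     [/\ lambda%:E = first_eigenvalue (Omega := Omega) (p := p)
                       porous_operator power_operator,
         mu%:E = lambda1_laplacian Omega &
         lambda = (2 / p * mu) ^+ 2]).
Proof.
have [oO nO _ bO] := domOmega.
split=> [p0 p1 p00 p10 pE|]; last exact: porous_eigenvalue.
have [lambda h1 h2] := mixed_eigenvalue n_ge1 oO nO bO p_ge2 p00 p10 pE.
by exists lambda; split; [rewrite h1|rewrite -h2].
Qed.
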